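(* Let $\mathcal{A}$ be an irreducible simplicial hyperplane arrangement in $\mathbb{P}^3(\mathbb{R})$. If $m(\mathcal{A})=6$, then $\mathcal{A}$ is isomorphic to $\mathcal{A}(A_4)$ or to $\mathcal{A}(D_4)$. In particular, $\mathcal{A}$ is a simply laced Grünbaum–Shephard arrangement whose characteristic polynomial splits over $\mathbb{R}$.
   Context: An arrangement in $\mathbb{P}^3(\mathbb{R})$ is a finite set of projective hyperplanes (images of linear hyperplanes of $\mathbb{R}^4$) with empty common intersection; it induces a cell decomposition of $\mathbb{P}^3$, and two arrangements are isomorphic if their cell decompositions are isomorphic. The 3-cells are chambers; each is bounded by at least $4$ hyperplanes (walls); $\mathcal{A}$ is simplicial if every chamber has exactly $4$ walls. $\mathcal{A}$ is reducible if, after a linear change of coordinates, $\mathbb{R}^4=V_1\oplus V_2$ with $V_1,V_2\neq 0$ and every linear hyperplane corresponding to $\mathcal{A}$ is of the form $H_1\oplus V_2$ with $H_1$ a hyperplane of $V_1$ or $V_1\oplus H_2$ with $H_2$ a hyperplane of $V_2$ (i.e. $\mathcal{A}$ is a product of two arrangements); otherwise it is irreducible. Vertices are the points of $\mathbb{P}^3$ that are intersections of hyperplanes of $\mathcal{A}$ (1-dimensional intersections in $\mathbb{R}^4$), lines the 2-dimensional intersections in $\mathbb{R}^4$; weights count the hyperplanes containing them; $h^\mathcal{A}_i$ is the number of lines of weight $i$, and $m(\mathcal{A})$ is the maximal weight of a vertex. $\mathcal{A}(A_4)$ is the reflection arrangement of the Coxeter group $A_4$ (the $10$ hyperplanes $x_i=x_j$,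 $1\le i<j\le5$, in $\{x\in\mathbb{R}^5:\sum x_i=0\}\cong\mathbb{R}^4$), and $\mathcal{A}(D_4)$ is the reflection arrangement of $D_4$ (the $12$ hyperplanes $x_i=\pm x_j$, $1\le i<j\le 4$, in $\mathbb{R}^4$), viewed projectively. $\mathcal{A}$ is simply laced if for every chamber $C$ and every pair of distinct walls $H,H'$ of $C$, at most three hyperplanes contain $H\cap H'$. $\mathcal{A}$ is a Grünbaum–Shephard arrangement if $h^\mathcal{A}_2>\sum_{i\ge3}h^\mathcal{A}_i$. The characteristic polynomial is $\chi(\mathcal{A},t)=\sum_{X\in L}\mu(\mathbb{R}^4,X)t^{\dim X}$ with $L$ the intersection lattice (reverse inclusion) and $\mu$ its Möbius function. *)

(* Defs.v *)
From HB Require Import structures.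
From mathcomp Require Import all_boot all_order all_algebra.
From mathcomp Require Import reals.
Set Implicit Arguments. Unset Strict Implicit. Unset Printing Implicit Defensive.
Import Order.TTheory GRing.Theory Num.Theory.
Local Open Scope ring_scope.

(* A (central, linear) arrangement in R^4 is given by a sequence [s] of normal
   row vectors; hyperplane i is H_i = { x | x . s`_i = 0 }.  Its image in
   P^3(R) is the projective arrangement of the paper. *)
Section Arr.
Variable R : realType.
Implicit Types (s : seq 'rV[R]_4).

Definition dotv (x a : 'rV[R]_4) : R := (x *m a^T) ord0 ord0.

Definition hyp s (i : nat) : 'M[R]_4 := kermx (s`_i)^T.

(* A finite set of (pairwise distinct) hyperplanes with trivial common
   intersection in R^4 (= empty common intersection in P^3). *)
Definition is_arrangement s : Prop :=
  [/\ forall i, (i < size s)%N -> s`_i != 0,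
      forall i j, (i < size s)%N -> (j < size s)%N -> i != j ->
                  ~~ (hyp s i == hyp s j)%MS
    & \rank (\matrix_(i < size s, k < 4) (s`_i) ord0 k) = 4%N].

Definition signv s := {ffun 'I_(size s) -> int}.

Definition is_cov s (sg : signv s) : Prop :=
  exists x : 'rV[R]_4, forall i : 'I_(size s), sg i = sgz (dotv x s`_i).

(* cells of P^3: nonzero sign vectors, modulo sg ~ -sg *)
Definition pcov s (sg : signv s) : Prop := is_cov sg /\ sg != [ffun=> 0].
Definition negv s (sg : signv s) : signv s := [ffun i => - sg i].
Definition facele s (sg tau : signv s) : bool :=
  [forall i, (sg i == 0) || (sg i == tau i)].
Definition pequiv s (sg tau : signv s) : bool := (sg == tau) || (sg == negv tau).
(* cell [sg] lies in the closure of cell [tau] in P^3 *)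
Definition pfacele s (sg tau : signv s) : bool :=
  facele sg tau || facele sg (negv tau).

(* isomorphism of the cell decompositions of P^3 (= isomorphism of the face
   posets of these regular cell complexes) *)
Definition cell_iso s t : Prop :=
  exists f : signv s -> signv t,
    [/\ forall sg, pcov sg -> pcov (f sg),
        forall tau, pcov tau -> exists2 sg, pcov sg & pequiv (f sg) tau
      & forall sg sg', pcov sg -> pcov sg' ->
          (pfacele sg sg' <-> pfacele (f sg) (f sg'))].

Definition chamber s (sg : signv s) : Prop := is_cov sg /\ forall i, sg i != 0.
Definition wall s (sg : signv s) (i : 'I_(size s)) : Prop :=
  exists x : 'rV[R]_4, dotv x s`_i = 0 /\
    forall j : 'I_(size s), j != i -> sgz (dotv x s`_j) = sg j.

Definition simplicial s : Prop :=
  forall sg : signv s, chamber sg ->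
    exists W : {set 'I_(size s)}, #|W| = 4%N /\ forall i, i \in W <-> wall sg i.

Definition reducible s : Prop :=
  exists V1 V2 : 'M[R]_4,
    [/\ V1 != 0, V2 != 0, (\rank V1 + \rank V2)%N = 4%N, (V1 + V2 == 1%:M)%MS
      & forall i, (i < size s)%N ->
         (exists H1 : 'M[R]_4, [/\ (H1 <= V1)%MS, \rank H1 = (\rank V1).-1
                                  & (hyp s i == H1 + V2)%MS]) \/
         (exists H2 : 'M[R]_4, [/\ (H2 <= V2)%MS, \rank H2 = (\rank V2).-1
                                  & (hyp s i == V1 + H2)%MS])].
Definition irreducible s : Prop := ~ reducible s.

Definition flat s (J : {set 'I_(size s)}) : 'M[R]_4 :=
  <<kermx (\matrix_(i < size s, k < 4) (if i \in J then (s`_i) ord0 k else 0))^T>>%MS.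
Definition flats s : seq 'M[R]_4 :=
  undup [seq flat J | J : {set 'I_(size s)}].
Definition weight s (X : 'M[R]_4) : nat :=
  #|[set i : 'I_(size s) | (X <= hyp s i)%MS]|.
(* vertices: dim 1; lines: dim 2 *)
Definition hnum s (k : nat) : nat :=
  count (fun X => (\rank X == 2%N) && (weight s X == k)) (flats s).
Definition mA s : nat := \max_(X <- flats s | \rank X == 1%N) weight s X.

Definition simply_laced s : Prop :=
  forall sg : signv s, chamber sg -> forall i j : 'I_(size s), i != j ->
    wall sg i -> wall sg j -> (weight s (@flat s [set i; j]) <= 3)%N.

Definition grunbaum_shephard s : Prop :=
  (\sum_(3 <= k < (size s).+1) hnum s k < hnum s 2)%N.

(* Moebius function mu(R^4, X) on L (reverse inclusion), computed
   recursively; fuel 4 suffices since chains in L have length <= 4. *)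
Fixpoint muF s (k : nat) (X : 'M[R]_4) : int :=
  if row_full X then 1 else
  match k with
  | 0 => 0
  | k'.+1 => - \sum_(Y <- flats s | (X < Y)%MS) muF s k' Y
  end.
Definition charpoly s : {poly R} :=
  \sum_(X <- flats s) ((muF s 4 X)%:~R *: 'X^(\rank X)).

Definition splits_over_R (p : {poly R}) : Prop :=
  exists rs : seq R, p = lead_coef p *: \prod_(r <- rs) ('X - r%:P).

Definition ev5 (i : 'I_5) : 'rV[R]_5 := \row_(k < 5) (if k == i then 1 else 0).
Definition ev4 (i : 'I_4) : 'rV[R]_4 := \row_(k < 4) (if k == i then 1 else 0).
(* linear iso R^4 -> {x in R^5 | sum x = 0}, y |-> (y1,..,y4, -(y1+..+y4)) *)
Definition P45 : 'M[R]_(4,5) :=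
  \matrix_(k < 4, l < 5) (if nat_of_ord l == nat_of_ord k then 1
                          else if nat_of_ord l == 4%N then -1 else 0).
(* A(A4): pull-backs of x_i = x_j, i < j in 'I_5 *)
Definition arrA4 : seq 'rV[R]_4 :=
  [seq (ev5 ij.1 - ev5 ij.2) *m P45^T | ij : 'I_5 * 'I_5 <- [seq (i, j) | i <- enum 'I_5, j <- enum 'I_5] & (ij.1 < ij.2)%N].
Definition arrD4 : seq 'rV[R]_4 :=
  [seq ev4 ij.1 - ev4 ij.2 | ij : 'I_4 * 'I_4 <- [seq (i, j) | i <- enum 'I_4, j <- enum 'I_4] & (ij.1 < ij.2)%N]
  ++ [seq ev4 ij.1 + ev4 ij.2 | ij : 'I_4 * 'I_4 <- [seq (i, j) | i <- enum 'I_4, j <- enum 'I_4] & (ij.1 < ij.2)%N].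

End Arr.

(* Main.v *)
Require Import Defs.
From HB Require Import structures.
From mathcomp Require Import all_boot all_order all_algebra.
From mathcomp Require Import reals boolp zify ring lra.
Set Implicit Arguments. Unset Strict Implicit. Unset Printing Implicit Defensive.
Import Order.TTheory GRing.Theory Num.Theory.
Local Open Scope ring_scope.

(* Call a vector a root when it is a nonzero multiple of a normal. The four inner wall
   normals of a simplicial chamber form a base: every root is a combination of them with
   coefficients of one sign. Crossing wall [i] replaces the base vectors [a_j] by
   [a_j + C_ij a_i] and [a_i] by [- a_i], with [C_ij >= 0], and [C_ij = 0] iff only two
   hyperplanes contain [H_i :&: H_j].
   If the graph of [C] is disconnected, walking through the chambers across the walls of one
   part only shows that every root is supported on one part, so the arrangement is reducible.
   If at most six hyperplanes contain each vertex, a connected triple of walls has exactly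
   the six roots of A_3; this forces [C_ij C_ji = 1] on edges, excludes triangles, and makes
   [C] the same for all chambers. A connected triangle-free graph on four nodes is a path, a
   star or a 4-cycle. The cycle is excluded because, walking away from a chamber, a suitable
   positive combination of the base vectors never decreases inside that chamber, so the
   opposite chamber would be out of reach. For the path and the star one rescales [C] to a
   0/1 matrix; then the roots are those of A_4 or D_4, and the remaining claims are finite
   computations with integer vectors. *)

(** No reflection group is given: crossing a wall changes the base by a linear map that depends on
    the chamber, and the [C_ij] are arbitrary nonnegative reals. Two devices replace group theory.
    The entry [C_ij] is intrinsic, namely the largest [c] with [a_j + c a_i] a root, so it does not
    depend on how the neighbouring base was found. And a statement about many chambers is an
    invariant carried along a walk towards a chosen point, where the number of hyperplanes
    separating the chamber from that point drops at each crossing. The bound six acts by pigeonhole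
    on supports: once six roots of a triple with six different supports are exhibited, roots with
    equal support are proportional and no other support occurs. Rescaling the base multiplies [C_ij]
    by [d_j / d_i]. On a tree this turns all edges into 1, but the product of the entries around a
    4-cycle is invariant; it can only be spread evenly, leaving [mu] and [1 / mu] in each row. The
    positive combination used against the cycle is the sum of the base vectors so rescaled, and it
    works because [mu + 1 / mu >= 2]. *)

Section DotProduct.
Variable R : realType.
Implicit Types (x y a b : 'rV[R]_4) (A : 'M[R]_4).

Lemma dotvDr x a b : dotv x (a + b) = dotv x a + dotv x b.
Proof. by rewrite /dotv linearD mulmxDr mxE. Qed.

Lemma dotvZr x t a : dotv x (t *: a) = t * dotv x a.
Proof. by rewrite /dotv linearZ /= -scalemxAr mxE. Qed.

Lemma dotvNr x a : dotv x (- a) = - dotv x a.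
Proof. by rewrite -scaleN1r dotvZr mulN1r. Qed.

Lemma dotvDl x y a : dotv (x + y) a = dotv x a + dotv y a.
Proof. by rewrite /dotv mulmxDl mxE. Qed.

Lemma dotvZl t x a : dotv (t *: x) a = t * dotv x a.
Proof. by rewrite /dotv -scalemxAl mxE. Qed.

Lemma dotvNl x a : dotv (- x) a = - dotv x a.
Proof. by rewrite -scaleN1r dotvZl mulN1r. Qed.

Lemma dotv_row x A i : dotv x (row i A) = (x *m A^T) 0 i.
Proof. by rewrite /dotv tr_row !mxE; apply: eq_bigr => k _; rewrite !mxE. Qed.

Lemma dotv_mulmx x u A : dotv x (u *m A) = \sum_i u 0 i * dotv x (row i A).
Proof.
rewrite /dotv trmx_mul mulmxA mxE; apply: eq_bigr => i _.
by rewrite -dotv_row mxE mulrC.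
Qed.

Lemma dotv_eq0 a : (forall x, dotv x a = 0) -> a = 0.
Proof.
move=> h; apply/rowP => j; rewrite mxE -(h (delta_mx 0 j)).
rewrite /dotv mxE (bigD1 j) //= !mxE !eqxx mul1r big1 ?addr0 // => k hk.
by rewrite !mxE eqxx (negPf hk) mul0r.
Qed.

Lemma point_of_values A (w : 'rV[R]_4) : A \in unitmx ->
  exists x, forall i, dotv x (row i A) = w 0 i.
Proof.
move=> uA; exists (w *m invmx A^T) => i.
by rewrite dotv_row mulmxKV // unitmx_tr.
Qed.

Lemma mem_hyp (s : seq 'rV[R]_4) x k : (x <= hyp s k)%MS = (dotv x s`_k == 0).
Proof.
rewrite /hyp /dotv; apply/sub_kermxP/eqP => [-> | h]; first by rewrite mxE.
by apply/matrixP => i j; rewrite !ord1 h mxE.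
Qed.

End DotProduct.

(** The tool for moving a point slightly while keeping finitely many strict inequalities. The
    denominator [1 + |g i|] in the proof avoids treating [g i = 0] separately. *)
Lemma small_eps (R : realType) (I : finType) (f g : I -> R) :
  (forall i, 0 < f i) -> exists2 e, 0 < e & forall i, 0 < f i + e * g i.
Proof.
move=> hf.
suff [e he h] : exists2 e, 0 < e & forall i, i \in enum I -> 0 < f i + e * g i.
  by exists e => // i; apply: h; rewrite mem_enum.
elim: (enum I) => [|i l [e he IH]]; first by exists 1.
have hd : 0 < 1 + `|g i| by rewrite ltr_pwDl.
exists (Num.min e (f i / (1 + `|g i|))).
  by rewrite lt_min he divr_gt0.
set d := Num.min _ _.
have hd0 : 0 < d by rewrite lt_min he divr_gt0.
move=> j; rewrite inE => /orP [/eqP -> | hj].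
  have h1 : d <= f i / (1 + `|g i|) by rewrite ge_min lexx orbT.
  have h2 : d * `|g i| < f i.
    apply: (@lt_le_trans _ _ (d * (1 + `|g i|))).
      by rewrite ltr_pM2l // ltrDr.
    by rewrite -ler_pdivlMr.
  have h3 : - `|g i| <= g i by rewrite lerNl -normrN ler_norm.
  have h4 : d * - `|g i| <= d * g i by rewrite ler_pM2l.
  rewrite mulrN in h4; lra.
have hle : d <= e by rewrite ge_min lexx.
have hfe := IH j hj; case: (lerP 0 (g j)) => hg.
  by rewrite ltr_pwDl // mulr_ge0 // ltW.
apply: (lt_le_trans hfe); rewrite lerD2l.
by rewrite ler_nM2r.
Qed.

(** * Roots, and what distinctness and essentiality give in terms of normals *)

Section Roots.
Variables (R : realType) (s : seq 'rV[R]_4).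
Implicit Types (x y u v : 'rV[R]_4) (A B : 'M[R]_4).

Definition isroot v := exists k : 'I_(size s), exists2 t, t != 0 & v = t *: s`_k.

(* [A] is the matrix of inner normals of a simplicial chamber. *)
Definition base A := [/\ A \in unitmx, forall i, isroot (row i A) &
  forall u, isroot (u *m A) -> (forall i, 0 <= u 0 i) \/ (forall i, u 0 i <= 0)].

Lemma isrootZ t v : t != 0 -> isroot v -> isroot (t *: v).
Proof.
by move=> ht [k [r hr ->]]; exists k, (t * r); rewrite ?mulf_neq0 ?scalerA.
Qed.

Lemma isrootN v : isroot v -> isroot (- v).
Proof. by move=> h; rewrite -scaleN1r; apply: isrootZ; rewrite ?oppr_eq0 ?oner_eq0. Qed.

Hypothesis arr : is_arrangement s.

Lemma isroot_nz v : isroot v -> v != 0.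
Proof.
by case=> k [t ht ->]; rewrite scaler_eq0 negb_or ht; case: arr => h _ _; apply: h.
Qed.

Lemma rank_hyp (k : 'I_(size s)) : \rank (hyp s k) = 3%N.
Proof.
rewrite /hyp mxrank_ker mxrank_tr rank_rV.
by case: arr => h _ _; rewrite h.
Qed.

Lemma hyp_neq (i j : 'I_(size s)) : i != j ->
  exists2 u, dotv u s`_i = 0 & dotv u s`_j != 0.
Proof.
move=> hij; case: arr => _ h _.
have hn : ~~ (hyp s i <= hyp s j)%MS.
  apply/negP => hs; move/negP: (h i j (ltn_ord i) (ltn_ord j) hij); apply.
  by rewrite -(mxrank_leqif_eq hs) !rank_hyp.
have [k hk] := row_subPn hn.
exists (row k (hyp s i)).
  by apply/eqP; rewrite -mem_hyp row_sub.
by rewrite -mem_hyp.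
Qed.

Lemma arr_ess y : (forall k : 'I_(size s), dotv y s`_k = 0) -> y = 0.
Proof.
case: arr => _ _ hr hy.
set M := (\matrix_(i, k) _) in hr.
have h0 : y *m M^T = 0.
  apply/rowP => k; rewrite [RHS]mxE -(hy k) /dotv !mxE.
  by apply: eq_bigr => j _; rewrite !mxE.
have : row_free M^T by rewrite -row_leq_rank mxrank_tr hr.
move/row_free_inj => hi; apply: (hi 1%N).
by rewrite h0 mul0mx.
Qed.

Lemma hyp_inj (i j : 'I_(size s)) t : t != 0 -> s`_i = t *: s`_j -> i = j.
Proof.
move=> ht e; apply/eqP/negP => /negP hij.
have [u h1 /negP] := hyp_neq hij; apply.
by move: h1; rewrite e dotvZr => /eqP; rewrite mulf_eq0 (negPf ht).
Qed.

End Roots.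

(** * Chambers and bases *)

Section ChamberBase.
Variables (R : realType) (s : seq 'rV[R]_4).
Hypotheses (arr : is_arrangement s) (spl : simplicial s).
Implicit Types (x y u v : 'rV[R]_4) (A B : 'M[R]_4).

Lemma ge0_of_eps (a b : R) : (forall e, 0 < e -> 0 < a + e * b) -> 0 <= a.
Proof.
move=> h; rewrite leNgt; apply/negP => ha.
have hb : 0 < b by have := h 1 ltr01; lra.
have h1 : 0 < - a / b by rewrite divr_gt0 // oppr_gt0.
by have := h _ h1; rewrite divfK ?gt_eqF // subrr ltxx.
Qed.

(* A minimal subset of the inequalities defining the chamber of [x] consists
   of walls: dropping one of them lets a segment leave the chamber through it. *)
Lemma walls_define_chamber x y :
  (forall k : 'I_(size s), dotv x s`_k != 0) ->
  (forall k, wall [ffun i : 'I_(size s) => sgz (dotv x s`_i)] k ->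
     0 < dotv x s`_k * dotv y s`_k) ->
  forall k : 'I_(size s), 0 < dotv x s`_k * dotv y s`_k.
Proof.
move=> hx hy.
(* [D W]: the inequalities indexed by [W] already imply all the others. *)
pose D (W : {set 'I_(size s)}) := forall z,
  (forall k, k \in W -> 0 < dotv x s`_k * dotv z s`_k) ->
  forall k : 'I_(size s), 0 < dotv x s`_k * dotv z s`_k.
have DT : [exists W : {set 'I_(size s)}, `[< D W >]].
  by apply/existsP; exists setT; apply/asboolP => z h k; apply: h; rewrite inE.
have [W hW] := ex_minset (existsP DT).
have {hW} [/asboolP DW Wmin] := minsetP hW.
apply: (DW y) => w wW; apply: hy.
have nD : ~ D (W :\ w).
  move=> hD; have /asboolP hb := hD.
  by have /setP/(_ w) := Wmin _ hb (subsetDl _ _); rewrite !inE eqxx wW.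
have [z hz1 [k0 hk0]] : exists2 z, (forall k, k \in W :\ w -> 0 < dotv x s`_k * dotv z s`_k)
    & exists k : 'I_(size s), ~~ (0 < dotv x s`_k * dotv z s`_k).
  apply: contrapT => h; apply: nD => z h1 k; apply: contrapT => /negP h2.
  by apply: h; exists z => //; exists k.
have hxx k : 0 < dotv x s`_(k : 'I_(size s)) * dotv x s`_k.
  by rewrite -expr2 exprn_even_gt0 //= hx.
have hwz : dotv x s`_w * dotv z s`_w <= 0.
  rewrite leNgt; apply/negP => hw; move/negP: hk0; apply; apply: DW => k kW.
  case: (eqVneq k w) => [-> // | hk]; apply: hz1; by rewrite !inE hk.
set a := dotv x s`_w * dotv x s`_w in hxx.
set b := dotv x s`_w * dotv z s`_w in hwz.
have ha : 0 < a := hxx w.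
(* The point, up to a positive factor, where the segment from [x] to [z] meets the hyperplane
   [w]. *)
pose p := - b *: x + a *: z.
have pk k : dotv x s`_k * dotv p s`_k =
   - b * (dotv x s`_k * dotv x s`_k) + a * (dotv x s`_k * dotv z s`_k).
  by rewrite /p dotvDl !dotvZl; ring.
have pw : dotv p s`_w = 0.
  apply: (mulfI (hx w)); rewrite pk mulr0 -/a -/b; ring.
have {pk} pW k : k \in W -> k != w -> 0 < dotv x s`_k * dotv p s`_k.
  move=> kW hk; rewrite pk ltr_wpDl //.
    by rewrite mulr_ge0 ?oppr_ge0 // ltW.
  by rewrite mulr_gt0 // hz1 // !inE hk.
clearbody p.
have closure q : dotv q s`_w = 0 ->
    (forall k, k \in W -> k != w -> 0 < dotv x s`_k * dotv q s`_k) ->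
    forall k : 'I_(size s), 0 <= dotv x s`_k * dotv q s`_k.
  move=> qw qW k; apply: (@ge0_of_eps _ (dotv x s`_k * dotv x s`_k)) => e he.
  have -> : dotv x s`_k * dotv q s`_k + e * (dotv x s`_k * dotv x s`_k) =
    dotv x s`_k * dotv (q + e *: x) s`_k by rewrite dotvDl dotvZl; ring.
  apply: DW => j jW; rewrite dotvDl dotvZl mulrDr mulrCA.
  case: (eqVneq j w) => [-> | hj].
    by rewrite qw mulr0 add0r mulr_gt0.
  by rewrite ltr_wpDr ?qW // mulr_ge0 // ltW.
exists p; split=> // j hj; rewrite ffunE.
suff : 0 < dotv x s`_j * dotv p s`_j.
  move=> h; apply/eqP; rewrite eq_sym.
  by move: h; rewrite -sgz_gt0 sgzM; do 2 case: sgzP.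
rewrite lt_neqAle closure // andbT eq_sym mulf_neq0 //.
apply/negP => /eqP pj.
(* If [p] lay on a second hyperplane [j], a small move inside the hyperplane [w] to the negative
   side of [j] would respect [W] and yet leave the closed chamber. *)
have [u0 u0w u0j] : exists2 u, dotv u s`_w = 0 & dotv u s`_j != 0.
  by apply: (hyp_neq arr); rewrite eq_sym.
have [u uw uj] : exists2 u, dotv u s`_w = 0 & dotv x s`_j * dotv u s`_j < 0.
  case: (ltrP (dotv x s`_j * dotv u0 s`_j) 0) => h; first by exists u0.
  exists (- u0); first by rewrite dotvNl u0w oppr0.
  by rewrite dotvNl mulrN oppr_lt0 lt_neqAle h andbT eq_sym mulf_neq0.
have [e he hep] := @small_eps R {k | (k \in W) && (k != w)}
   (fun k => dotv x s`_(val k) * dotv p s`_(val k))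
   (fun k => dotv x s`_(val k) * dotv u s`_(val k))
   (fun k => let: conj h1 h2 := andP (valP k) in pW _ h1 h2).
have h2 k : k \in W -> k != w -> 0 < dotv x s`_k * dotv (p + e *: u) s`_k.
  move=> kW hk; have hkk : (k \in W) && (k != w) by rewrite kW.
  have := hep (Sub k hkk); rewrite /= dotvDl dotvZl => h.
  by rewrite mulrDr (mulrCA _ e).
have h1 : dotv (p + e *: u) s`_w = 0 by rewrite dotvDl dotvZl pw uw mulr0 addr0.
have := closure _ h1 h2 j; rewrite dotvDl dotvZl pj add0r mulrCA.
by rewrite pmulr_rge0 // leNgt uj.
Qed.

(** The rows are the normals of the four walls, turned towards [x]. They are independent because a
    vector orthogonal to all of them can be added to [x] with any factor without leaving the
    chamber, hence is orthogonal to every normal. A root keeps its sign on the chamber, and letting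
    the [i]-th coordinate of a point grow makes this the sign of the [i]-th coefficient. *)
Lemma chamber_base x : (forall k : 'I_(size s), dotv x s`_k != 0) ->
  exists2 A, base s A & forall i, 0 < dotv x (row i A).
Proof.
move=> hx; pose sg := [ffun i : 'I_(size s) => sgz (dotv x s`_i)].
have hch : chamber sg.
  split; first by exists x => i; rewrite ffunE.
  by move=> i; rewrite ffunE sgz_eq0.
have [W [cW hW]] := spl hch.
pose e (i : 'I_4) : 'I_(size s) := enum_val (cast_ord (esym cW) i).
have eW i : e i \in W by apply: enum_valP.
have eS k : k \in W -> exists i, e i = k.
  move=> kW; exists (cast_ord cW (enum_rank_in kW k)).
  by rewrite /e cast_ordK enum_rankK_in.
pose A := \matrix_(i < 4) (dotv x s`_(e i) *: s`_(e i)).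
have rA i : row i A = dotv x s`_(e i) *: s`_(e i) by rewrite rowK.
have pA y : (forall i, 0 < dotv y (row i A)) ->
    forall k : 'I_(size s), 0 < dotv x s`_k * dotv y s`_k.
  move=> hy; apply: walls_define_chamber => // k /hW /eS [i <-].
  by have := hy i; rewrite rA dotvZr.
have xA i : 0 < dotv x (row i A).
  by rewrite rA dotvZr -expr2 exprn_even_gt0 //= hx.
have uA : A \in unitmx.
  rewrite -unitmx_tr -row_free_unit -kermx_eq0; apply/rowV0P => y /sub_kermxP hy.
  have hyi i : dotv y (row i A) = 0 by rewrite dotv_row hy mxE.
  apply: (arr_ess arr) => k; apply: (mulfI (hx k)); rewrite mulr0.
  have hz t : 0 < dotv x s`_k * dotv x s`_k + t * (dotv x s`_k * dotv y s`_k).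
    have -> : dotv x s`_k * dotv x s`_k + t * (dotv x s`_k * dotv y s`_k) =
       dotv x s`_k * dotv (x + t *: y) s`_k by rewrite dotvDl dotvZl; ring.
    by apply: pA => i; rewrite dotvDl dotvZl hyi mulr0 addr0.
  set b := dotv x s`_k * dotv y s`_k in hz *; set a := dotv x s`_k * dotv x _ in hz.
  apply/eqP/negP => /negP hb; have := hz (- a / b).
  by rewrite divfK // subrr ltxx.
exists A => //; split=> // [i | u [k [t ht eu]]].
  by rewrite rA; exists (e i), (dotv x s`_(e i)).
have hpos y : (forall i, 0 < dotv y (row i A)) ->
    0 < (dotv x s`_k / t) * \sum_i u 0 i * dotv y (row i A).
  move=> hy; rewrite -dotv_mulmx eu dotvZr mulrA divfK //; exact: pA.
have hsg i : 0 <= dotv x s`_k / t * u 0 i.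
  rewrite leNgt; apply/negP => hi.
  set c := dotv x s`_k / t in hpos hi.
  pose S := c * \sum_(j | j != i) u 0 j.
  (* Chosen so that [c * u 0 i * L = c * u 0 i - |S|]: a negative coefficient would outweigh the
     other three terms. *)
  pose L := 1 + `|S| / - (c * u 0 i).
  have hL : 0 < L by rewrite /L ltr_pwDl // divr_ge0 // oppr_ge0 ltW.
  have [y hy] := point_of_values (\row_j (if j == i then L else 1)) uA.
  have := hpos y; have hyp0 j : 0 < dotv y (row j A).
    by rewrite hy mxE; case: ifP.
  move=> /(_ hyp0); rewrite (bigD1 i) //= hy mxE eqxx.
  have -> : \sum_(j | j != i) u 0 j * dotv y (row j A) = \sum_(j | j != i) u 0 j.
    by apply: eq_bigr => j hj; rewrite hy mxE (negPf hj) mulr1.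
  have eL : c * (u 0 i * L) = c * u 0 i - `|S|.
    by rewrite mulrA /L mulrDr mulr1 invrN mulrN mulrN mulrCA divff ?mulr1 // lt_eqF.
  rewrite mulrDr -/S eL.
  have := ler_norm S; lra.
have hc : dotv x s`_k / t != 0 by rewrite mulf_neq0 ?invr_eq0.
case: (ltrP 0 (dotv x s`_k / t)) => h; [left | right] => i; have := hsg i.
  by rewrite pmulr_rge0.
by rewrite nmulr_rge0 // lt_neqAle hc.
Qed.

End ChamberBase.

(** * Wall crossing *)

Section Crossing.
Variables (R : realType) (s : seq 'rV[R]_4).
Hypotheses (arr : is_arrangement s) (spl : simplicial s).
Implicit Types (x y u v : 'rV[R]_4) (A B C D : 'M[R]_4) (i j : 'I_4).

(* The base of the chamber adjacent to that of [B] across wall [i] is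
   [cross C i B], where [C] plays the role of (minus) a Cartan matrix;
   diagonal entries of [C] are irrelevant. *)
Definition cross C i B : 'M[R]_4 :=
  \matrix_j (if j == i then - row i B else row j B + C i j *: row i B).

(** The same crossing read on coefficients: it turns coordinates over [cross C i B] into coordinates
    over [B] and, being an involution, also back. *)
Definition refl C i u : 'rV[R]_4 :=
  \row_j (if j == i then - u 0 i + \sum_(k | k != i) C i k * u 0 k else u 0 j).

Lemma row_cross C i B j :
  row j (cross C i B) = if j == i then - row i B else row j B + C i j *: row i B.
Proof. by rewrite rowK. Qed.

Lemma row_cross_id C i B : row i (cross C i B) = - row i B.
Proof. by rewrite row_cross eqxx. Qed.

Lemma row_cross_neq C i B j : j != i ->
  row j (cross C i B) = row j B + C i j *: row i B.
Proof. by move=> /negPf h; rewrite row_cross h. Qed.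

Lemma mul_cross C i B u : u *m cross C i B = refl C i u *m B.
Proof.
rewrite !mulmx_sum_row (bigD1 i) //= [RHS](bigD1 i) //= mxE eqxx row_cross_id.
rewrite scalerDl scaleNr -scalerN -addrA; congr (_ + _).
rewrite scaler_suml -big_split; apply: eq_bigr => k hk.
rewrite mxE (negPf hk) row_cross_neq // scalerDr scalerA addrC.
by rewrite [u 0 k * _]mulrC.
Qed.

Lemma reflK C i : involutive (refl C i).
Proof.
move=> u; apply/rowP => j; rewrite mxE; case: eqP => [->|/eqP /negPf h].
  rewrite [refl _ _ _ 0 i]mxE eqxx opprD opprK.
  have -> : \sum_(k | k != i) C i k * refl C i u 0 k = \sum_(k | k != i) C i k * u 0 k.
    by apply: eq_bigr => k hk; rewrite mxE (negPf hk).
  by rewrite subrK.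
by rewrite mxE h.
Qed.

Lemma refl_mul_cross C i B u : refl C i u *m cross C i B = u *m B.
Proof. by rewrite mul_cross reflK. Qed.

Lemma unit_cross C i B : B \in unitmx -> cross C i B \in unitmx.
Proof.
move=> uB; rewrite -row_free_unit -kermx_eq0; apply/rowV0P => y /sub_kermxP.
rewrite mul_cross => /(congr1 (mulmx^~ (invmx B))); rewrite mul0mx mulmxK // => h.
rewrite -[y](reflK C i) h; apply/rowP => j; rewrite !mxE.
case: eqP => // _; rewrite oppr0 add0r big1 // => k _; by rewrite mxE mulr0.
Qed.

Lemma row_comb_inj B u v : B \in unitmx -> u *m B = v *m B -> u = v.
Proof. by move=> uB /(congr1 (mulmx^~ (invmx B))); rewrite !mulmxK. Qed.

Lemma root_coords B v : B \in unitmx -> exists u, v = u *m B.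
Proof. by move=> uB; exists (v *m invmx B); rewrite mulmxKV. Qed.

Lemma base_sum_ge0 B v y : base s B -> isroot s v ->
  (forall i, 0 < dotv y (row i B)) -> 0 < dotv y v ->
  exists2 u, v = u *m B & forall i, 0 <= u 0 i.
Proof.
move=> [uB _ hB] hv hy; have [u e] := root_coords v uB.
move: hv; rewrite e => /hB [h | h]; first by exists u.
rewrite dotv_mulmx ltNge => /negP []; apply: sumr_le0 => i _.
by rewrite mulr_le0_ge0 // ltW.
Qed.

(** The point [x] lies just beyond wall [i]. For small [e] every root that is not a multiple of the
    [i]-th base vector has at [x] the sign it had in the old chamber, which is the common sign of
    its coefficients. *)
Lemma generic_neighbour B i : base s B ->
  exists2 e, 0 < e & exists2 x,
    [/\ dotv x (row i B) = - e, forall j, j != i -> dotv x (row j B) = 1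
      & forall k : 'I_(size s), dotv x s`_k != 0]
    & forall u j, isroot s (u *m B) -> j != i -> u 0 j != 0 ->
      0 < u 0 j * dotv x (u *m B).
Proof.
move=> [uB rB hB].
pose S (k : 'I_(size s)) := \sum_(j | j != i) (s`_k *m invmx B) 0 j.
pose c (k : 'I_(size s)) := (s`_k *m invmx B) 0 i.
(* Coefficients of a root have one sign, so [S k = 0] happens only for multiples of [row i B]; these
   put no condition on [e] and get the dummy pair [1], [0]. *)
have hf k : 0 < if S k == 0 then 1 else S k * S k.
  by case: eqP => // /eqP h; rewrite -expr2 exprn_even_gt0.
have [e he hep] := small_eps (fun k => if S k == 0 then 0 else - (S k * c k)) hf.
have [x hx] := point_of_values (\row_j (if j == i then - e else 1)) uB.
have hxi : dotv x (row i B) = - e by rewrite hx mxE eqxx.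
have hxj j : j != i -> dotv x (row j B) = 1 by move=> h; rewrite hx mxE (negPf h).
have hk (k : 'I_(size s)) : dotv x s`_k = S k - e * c k.
  rewrite -[in LHS](mulmxKV uB s`_k) dotv_mulmx (bigD1 i) //= hxi addrC; congr (_ + _).
    by apply: eq_bigr => j hj; rewrite hxj // mulr1.
  by rewrite mulrN mulrC.
have rk (k : 'I_(size s)) : isroot s (s`_k *m invmx B *m B).
  by rewrite mulmxKV //; exists k, 1; rewrite ?oner_eq0 ?scale1r.
have S0 (k : 'I_(size s)) : S k = 0 -> forall j, j != i -> (s`_k *m invmx B) 0 j = 0.
  move=> h j hj; case: (hB _ (rk k)) => h1.
    have := @psumr_eq0P R _ (fun j => j != i) (fun j => (s`_k *m invmx B) 0 j).
    by move=> /(_ (fun j _ => h1 j) h); apply.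
  have h2 j' : j' != i -> 0 <= - (s`_k *m invmx B) 0 j' by rewrite oppr_ge0.
  have h3 : \sum_(j' | j' != i) - (s`_k *m invmx B) 0 j' = 0.
    by rewrite sumrN -/(S k) h oppr0.
  by have /eqP := psumr_eq0P h2 h3 hj; rewrite oppr_eq0 => /eqP.
have snz (k : 'I_(size s)) : s`_k != 0 by case: arr => h _ _; apply: h.
exists e => //; exists x.
  split=> // k; rewrite hk; have := hep k; case: eqP => [h0 _ | h0].
    rewrite h0 sub0r oppr_eq0 mulf_neq0 ?(gt_eqF he) //.
    apply/eqP => hc; move/negP: (snz k); apply.
    rewrite -(mulmxKV uB s`_k); have -> : s`_k *m invmx B = 0.
      apply/rowP => j; rewrite [RHS]mxE; case: (eqVneq j i) => [-> // | hj].
      exact: S0.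
    by rewrite mul0mx.
  move=> h; apply/eqP => h1; move: h.
  have -> : S k * S k + e * - (S k * c k) = S k * (S k - e * c k) by ring.
  by rewrite h1 mulr0 ltxx.
move=> u j [k [t ht eu]] hj huj.
have eu' : u = t *: (s`_k *m invmx B).
  by rewrite scalemxAl -eu mulmxK.
rewrite eu dotvZr hk eu' mxE.
have hnz : (s`_k *m invmx B) 0 j != 0.
  by apply: contraNneq huj => h; rewrite eu' mxE h mulr0.
have hS : S k != 0 by apply: contraNneq hnz => h; rewrite S0.
have := hep k; rewrite (negPf hS).
have -> : S k * S k + e * - (S k * c k) = S k * (S k - e * c k) by ring.
move=> h.
have h2 : 0 < (s`_k *m invmx B) 0 j * S k.
  have hmul : 0 <= (s`_k *m invmx B) 0 j * S k.
    case: (hB _ (rk k)) => h1.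
      by rewrite mulr_ge0 // sumr_ge0.
    by rewrite mulr_le0 // sumr_le0.
  by rewrite lt_neqAle hmul eq_sym mulf_neq0.
set P := (s`_k *m _) 0 j in hnz h2 *; set X := S k - _ in h *.
have -> : t * P * (t * X) = t ^+ 2 * (P * X) by ring.
rewrite mulr_gt0 ?exprn_even_gt0 //.
have h3 : 0 < (P * S k) * (S k * X) by rewrite mulr_gt0.
move: h3; have -> : P * S k * (S k * X) = (S k) ^+ 2 * (P * X) by ring.
by rewrite pmulr_rgt0 // exprn_even_gt0.
Qed.

(** Let [D] be the base of the chamber just beyond wall [i]; its rows have nonnegative
    [B]-coefficients off [i]. Writing [- row i B] and every other [row k B] as nonnegative
    combinations of the rows of [D] forces some row of [D] to be a positive multiple of [- row i B],
    respectively of [row k B + c *: row i B]. These four rows are distinct, so [D] is a crossed base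
    up to order and scaling. *)
Lemma cross_ex B i : base s B -> exists C, base s (cross C i B).
Proof.
move=> bB; have [e he [x [hxi hxj hxk] hpos]] := generic_neighbour i bB.
have [D bD hD] := chamber_base arr spl hxk.
have [uB rB hB] := bB; have [uD rD hDD] := bD.
pose w m := row m D *m invmx B.
have wE m : w m *m B = row m D by rewrite /w mulmxKV.
have wr m : isroot s (w m *m B) by rewrite wE.
have wx m : 0 < dotv x (w m *m B) by rewrite wE.
have w_ge0 m j : j != i -> 0 <= w m 0 j.
  move=> hj; case: (eqVneq (w m 0 j) 0) => [-> // | h].
  by have := hpos _ _ (wr m) hj h; rewrite pmulr_lgt0 // => /ltW.
have coordB v z j : v = z *m D -> (v *m invmx B) 0 j = \sum_m z 0 m * w m 0 j.
  move=> ->; rewrite (mulmx_sum_row z D) mulmx_suml summxE.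
  by apply: eq_bigr => m _; rewrite -scalemxAl !mxE.
have rowB (k : 'I_4) : row k B *m invmx B = delta_mx 0 k by rewrite rowE mulmxK.
(* [pc.1] is the scaling factor and [pc.2] the future entry [C i k], a placeholder when [k = i]. *)
have key (k : 'I_4) : exists m, exists pc : R * R, 0 < pc.1 /\
   row m D = pc.1 *: (if k == i then - row i B else row k B + pc.2 *: row i B).
  case: (eqVneq k i) => [_ | hk].
    have ri : isroot s (- row i B) by apply: isrootN.
    have xi : 0 < dotv x (- row i B) by rewrite dotvNr hxi opprK.
    have [z ez hz] := base_sum_ge0 bD ri hD xi.
    have [m hm] : exists m, z 0 m * w m 0 i < 0.
      apply: contrapT => h; have := coordB _ _ i ez.
      rewrite mulNmx rowB !mxE !eqxx => h1.
      have : 0 <= \sum_m z 0 m * w m 0 i.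
        apply: sumr_ge0 => m _; rewrite leNgt; apply/negP => h2; by apply: h; exists m.
      by rewrite -h1 oppr_ge0 ler10.
    have wm : w m 0 i < 0.
      rewrite ltNge; apply/negP => h; move: hm; rewrite ltNge mulr_ge0 //.
    exists m, (- w m 0 i, 0); rewrite oppr_gt0 scaleNr scalerN opprK; split=> //.
    rewrite -wE mulmx_sum_row (bigD1 i) //= big1 ?addr0 // => j hj.
    case: (hB _ (wr m)) => h; first by have := h i; rewrite leNgt wm.
    have -> : w m 0 j = 0 by apply/eqP; rewrite eq_le h w_ge0.
    by rewrite scale0r.
  have xk : 0 < dotv x (row k B) by rewrite hxj.
  have [z ez hz] := base_sum_ge0 bD (rB k) hD xk.
  have cj j : \sum_m z 0 m * w m 0 j = (k == j)%:R.
    by rewrite -(coordB _ _ j ez) rowB !mxE eqxx eq_sym.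
  have [m hm] : exists m, z 0 m * w m 0 k != 0.
    apply: contrapT => h; have := cj k; rewrite eqxx big1 => [/eqP|m _].
      by rewrite eq_sym oner_eq0.
    by apply/eqP; apply: contrapT => /negP h1; apply: h; exists m.
  have [zm wk] : z 0 m != 0 /\ w m 0 k != 0.
    by move: hm; rewrite mulf_eq0 negb_or => /andP.
  exists m, (w m 0 k, w m 0 i / w m 0 k) => /=; split.
    by rewrite lt_neqAle eq_sym wk w_ge0.
  rewrite scalerDr scalerA mulrCA divff // mulr1 -wE mulmx_sum_row.
  rewrite (bigD1 k) //= (bigD1 i) ?(eq_sym i) //= big1 ?addr0 // => j /andP [hjk hji].
  (* The [j]-th coefficient of [row k B] is zero and is a sum of nonnegative terms, so each term
     vanishes. *)
  have : z 0 m * w m 0 j = 0.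
    have := @psumr_eq0P R _ predT (fun m => z 0 m * w m 0 j).
    move=> /(_ (fun m _ => mulr_ge0 (hz m) (w_ge0 m j hji))); rewrite cj.
    by rewrite eq_sym (negPf hjk) => /(_ erefl m erefl).
  by move/eqP; rewrite mulf_eq0 (negPf zm) => /eqP ->; rewrite scale0r.
have [mu /fin_all_exists [pc hpc]] := fin_all_exists key.
pose C : 'M[R]_4 := \matrix_(a, k) (pc k).2.
exists C; set E := cross C i B.
have uE : E \in unitmx by apply: unit_cross.
have rE k : row (mu k) D = (pc k).1 *: row k E.
  by have [_ ->] := hpc k; rewrite row_cross mxE.
have p0 k : 0 < (pc k).1 by have [] := hpc k.
have muI : injective mu.
  move=> k k' ekk; have : (pc k).1 *: row k E = (pc k').1 *: row k' E.
    by rewrite -!rE ekk.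
  rewrite !rowE !scalemxAl => /(row_comb_inj uE) /rowP /(_ k).
  rewrite !mxE !eqxx mulr1 /=; case: eqP => // _ /eqP.
  by rewrite mulr0 gt_eqF.
split=> // [k | u].
  have -> : row k E = (pc k).1^-1 *: row (mu k) D.
    by rewrite rE scalerA mulVf ?scale1r // gt_eqF.
  by apply: isrootZ; rewrite ?invr_eq0 ?gt_eqF.
pose z := \row_m (u 0 (invF muI m) / (pc (invF muI m)).1).
have zm k : z 0 (mu k) = u 0 k / (pc k).1 by rewrite mxE invF_f.
have -> : u *m E = z *m D.
  rewrite !mulmx_sum_row [RHS](reindex_inj muI) /=; apply: eq_bigr => k _.
  by rewrite zm rE scalerA divfK // gt_eqF.
move=> /hDD [h | h]; [left | right] => k; have := h (mu k); rewrite zm.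
  by rewrite pmulr_lge0 // invr_gt0.
by rewrite pmulr_lle0 // invr_gt0.
Qed.

(** [c] is the extreme slope among the roots in the plane of [a_i] and [a_j] with positive
    [a_j]-coefficient. This mentions no neighbouring chamber, whence the uniqueness below. *)
Definition cart B i j (c : R) := isroot s (row j B + c *: row i B) /\
  forall a b, 0 < a -> isroot s (a *: row j B + b *: row i B) -> b <= c * a.

Definition Cart B C := forall i j, i != j -> cart B i j (C i j).

Lemma cart_uniq B i j c c' : cart B i j c -> cart B i j c' -> c = c'.
Proof.
move=> [r1 h1] [r2 h2]; apply/eqP; rewrite eq_le; apply/andP.
by split; rewrite -[leRHS]mulr1; [apply: h2 | apply: h1]; rewrite ?scale1r.
Qed.

(** Over the crossed base the vector [a *: row j B + b *: row i B] has coefficients [a] and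
    [C i j * a - b], which must have the same sign. *)
Lemma cart_cross B C i j : base s (cross C i B) -> j != i -> cart B i j (C i j).
Proof.
move=> [uE rE hE] hj; split; first by have := rE j; rewrite row_cross_neq.
move=> a b ha hr.
have e : a *: row j B + b *: row i B =
   (a *: delta_mx 0 j + (C i j * a - b) *: delta_mx 0 i) *m cross C i B.
  rewrite mulmxDl -!scalemxAl -!rowE row_cross_id row_cross_neq // scalerDr scalerN.
  by rewrite -addrA scalerA -scaleNr -scalerDl; congr (_ + _ *: _); ring.
move: hr; rewrite e => /hE [] h; have := h i; have := h j; rewrite !mxE !eqxx.
  by rewrite (negPf hj) (eq_sym i) (negPf hj) /=; lra.
by rewrite (negPf hj) (eq_sym i) (negPf hj) /=; lra.
Qed.

Lemma cart_ex B : base s B -> exists C, Cart B C.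
Proof.
move=> bB.
have /fin_all_exists [F hF] : forall i, exists C, base s (cross C i B).
  by move=> i; apply: cross_ex.
exists (\matrix_(i, j) F i i j) => i j hij; rewrite mxE.
by apply: cart_cross => //; rewrite eq_sym.
Qed.

Lemma cross_base B C i : base s B -> Cart B C -> base s (cross C i B).
Proof.
move=> bB hC; have [C0 h0] := cross_ex i bB.
suff <- : cross C0 i B = cross C i B by [].
apply/row_matrixP => j; rewrite !row_cross; case: eqP => // /eqP hj.
congr (_ + _ *: _); apply: cart_uniq (cart_cross h0 hj) (hC _ _ _).
by rewrite eq_sym.
Qed.

End Crossing.

(** * Walks and reducibility *)

Section Walks.
Variables (R : realType) (s : seq 'rV[R]_4).
Hypotheses (arr : is_arrangement s) (spl : simplicial s).
Implicit Types (x y u v : 'rV[R]_4) (A B C D : 'M[R]_4) (i j : 'I_4).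

Lemma cart_ge0 B C i j : base s B -> Cart s B C -> i != j -> 0 <= C i j.
Proof.
move=> [_ rB _] hC hij; have [_ h] := hC _ _ hij.
by have := h 1 0 ltr01; rewrite scale1r scale0r addr0 mulr1; apply.
Qed.

(** A positive entry [C j i] yields a root with both coefficients positive in this plane, which a
    zero entry [C i j] forbids. *)
Lemma cart_eq0_sym B C i j : base s B -> Cart s B C -> i != j ->
  C i j = 0 -> C j i = 0.
Proof.
move=> bB hC hij h0; have hji : j != i by rewrite eq_sym.
apply/eqP/negP => /negP hn.
have hp : 0 < C j i by rewrite lt_neqAle eq_sym hn (cart_ge0 bB hC).
have [r _] := hC _ _ hji; have [_ h] := hC _ _ hij.
have := h (C j i) 1 hp; rewrite scale1r addrC h0 mul0r => /(_ r).
by rewrite ler10.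
Qed.

Lemma cart_cross_back B C i j : base s B -> Cart s B C -> i != j ->
  cart s (cross C i B) i j (C i j).
Proof.
move=> [uB rB hB] hC hij; have hji : j != i by rewrite eq_sym.
rewrite /cart row_cross_id row_cross_neq //; split; first by rewrite scalerN addrK.
move=> a b ha; rewrite scalerDr scalerA scalerN -scaleNr -addrA -scalerDl.
have -> : a *: row j B + (a * C i j + - b) *: row i B =
  (a *: delta_mx 0 j + (a * C i j - b) *: delta_mx 0 i) *m B.
  by rewrite mulmxDl -!scalemxAl -!rowE.
move=> /hB [] h; have := h i; have := h j; rewrite !mxE !eqxx.
  by rewrite (negPf hji) (negPf hij) /=; lra.
by rewrite (negPf hji) (negPf hij) /=; lra.
Qed.

(* Crossing wall [k] only negates the [k]-coordinate of such a root. *)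
Lemma isolated_root B C k u : base s B -> Cart s B C -> isroot s (u *m B) ->
  (forall j, j != k -> u 0 j != 0 -> C k j = 0) ->
  u 0 k != 0 -> forall j, j != k -> u 0 j = 0.
Proof.
move=> bB hC hr h0 hk j hj; have [_ _ hE] := cross_base arr spl k bB hC.
have [_ _ hB] := bB.
move: (hr); rewrite -(refl_mul_cross C k) => /hE hr'.
have ek : refl C k u 0 k = - u 0 k.
  rewrite mxE eqxx big1 ?addr0 // => m hm.
  by case: (eqVneq (u 0 m) 0) => [-> | /h0 ->]; rewrite ?mulr0 ?mul0r.
have ej : refl C k u 0 j = u 0 j by rewrite mxE (negPf hj).
apply/eqP; rewrite eq_le.
case: (hB _ hr) hr' => h [] h'; have := h' j; have := h' k; have := h j; have := h k;
  rewrite ek ej => h1 h2 h3 h4; rewrite ?h2 ?h4 //; case/eqP: hk; lra.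
Qed.

Definition inner B : 'rV[R]_4 := const_mx 1 *m invmx B^T.

Lemma inner_row B i : B \in unitmx -> dotv (inner B) (row i B) = 1.
Proof. by move=> uB; rewrite dotv_row mulmxKV ?unitmx_tr // mxE. Qed.

Lemma inner_comb B u : B \in unitmx -> dotv (inner B) (u *m B) = \sum_i u 0 i.
Proof.
move=> uB; rewrite dotv_mulmx; apply: eq_bigr => i _.
by rewrite inner_row // mulr1.
Qed.

Definition separating B y :=
  [set k : 'I_(size s) | dotv (inner B) s`_k * dotv y s`_k < 0].

(** A root with a nonzero coefficient off [i] keeps that coefficient when wall [i] is crossed, so it
    has the same sign at the two inner points. *)
Lemma inner_cross B C i v : base s B -> Cart s B C -> isroot s v ->
  (exists t, v = t *: row i B) \/
  (forall z, dotv (inner (cross C i B)) v * z < 0 -> dotv (inner B) v * z < 0).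
Proof.
move=> bB hC hv; have bE := cross_base arr spl i bB hC.
have [uB rB hB] := bB; have [uE rE hE] := bE.
have [u eu] := root_coords v uB.
case: (EM (exists2 j, j != i & u 0 j != 0)) => [[j hj hu] | hn]; last first.
  left; exists (u 0 i); rewrite eu mulmx_sum_row (bigD1 i) //= big1 ?addr0 // => j hj.
  suff -> : u 0 j = 0 by rewrite scale0r.
  by apply/eqP; apply: contrapT => /negP h; apply: hn; exists j.
right => z.
have hr : isroot s (u *m B) by rewrite -eu.
have hr' : isroot s (refl C i u *m cross C i B) by rewrite refl_mul_cross.
have e1 : dotv (inner B) v = \sum_i u 0 i by rewrite eu inner_comb.
have e2 : dotv (inner (cross C i B)) v = \sum_m refl C i u 0 m.
  by rewrite eu -(refl_mul_cross C i) inner_comb.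
have ej : refl C i u 0 j = u 0 j by rewrite mxE (negPf hj).
rewrite e1 e2.
case: (hB _ hr) (hE _ hr') => h [] h'.
- rewrite !pmulr_rlt0 //.
    by rewrite (bigD1 j) //= ltr_wpDr ?sumr_ge0 // lt_neqAle eq_sym hu h.
  by rewrite (bigD1 j) //= ltr_wpDr ?sumr_ge0 // ej lt_neqAle eq_sym hu h.
- by case/eqP: hu; apply/eqP; rewrite eq_le h -ej h'.
- by case/eqP: hu; apply/eqP; rewrite eq_le h -ej h'.
rewrite !nmulr_rlt0 //.
  by rewrite -oppr_gt0 -sumrN (bigD1 j) //= ltr_wpDr ?sumr_ge0 // =>
    [m _|]; rewrite ?oppr_ge0 ?oppr_gt0 ?h // lt_neqAle hu h.
by rewrite -oppr_gt0 -sumrN (bigD1 j) //= ltr_wpDr ?sumr_ge0 // =>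
    [m _|]; rewrite ?oppr_ge0 ?oppr_gt0 ?h' // ej lt_neqAle hu h.
Qed.

Lemma separating_cross B C i y : base s B -> Cart s B C ->
  dotv y (row i B) < 0 ->
  (#|separating (cross C i B) y| < #|separating B y|)%N.
Proof.
move=> bB hC hy; have [uB rB _] := bB; have [k [t ht ek]] := rB i.
have uE := unit_cross C i uB.
apply: proper_card; apply/properP; split.
  apply/subsetP => m; rewrite !inE.
  have rm : isroot s s`_m by exists m, 1; rewrite ?oner_eq0 ?scale1r.
  have [[r er] | h] := inner_cross i bB hC rm; last by apply: h.
  rewrite er !dotvZr inner_row // -[row i B]opprK -(row_cross_id C) dotvNr inner_row //.
  rewrite row_cross_id opprK.
  case: (eqVneq r 0) => [-> | hr]; first by rewrite !mul0r.
  have h2 : 0 < r ^+ 2 by rewrite exprn_even_gt0.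
  have -> : r * -1 * (r * dotv y (row i B)) = r ^+ 2 * - dotv y (row i B) by ring.
  by rewrite pmulr_rlt0 // oppr_lt0 ltNge (ltW hy).
have ek' : s`_k = t^-1 *: row i B by rewrite ek scalerA mulVf // scale1r.
have h2 : 0 < t^-1 ^+ 2 by rewrite exprn_even_gt0 // invr_eq0.
exists k; rewrite inE ek' !dotvZr.
  rewrite inner_row //.
  have -> : t^-1 * 1 * (t^-1 * dotv y (row i B)) = t^-1 ^+ 2 * dotv y (row i B) by ring.
  by rewrite pmulr_rlt0.
rewrite -{1}[row i B]opprK -(row_cross_id C) dotvNr inner_row //.
have -> : t^-1 * -1 * (t^-1 * dotv y (row i B)) = t^-1 ^+ 2 * - dotv y (row i B) by ring.
by rewrite pmulr_rlt0 // oppr_lt0 ltNge (ltW hy).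
Qed.

(** Induction along galleries: as long as [y] is strictly beyond some wall, that wall is crossed. An
    invariant kept by such crossings thus reaches a chamber whose closure contains [y]. *)
Lemma walk (Inv : 'M[R]_4 -> Prop) y A : Inv A ->
  (forall B, Inv B -> base s B) ->
  (forall B C i, Inv B -> Cart s B C -> dotv y (row i B) < 0 -> Inv (cross C i B)) ->
  exists2 B, Inv B & forall i, 0 <= dotv y (row i B).
Proof.
move=> IA hb hs; have [n] := ubnP #|separating A y|.
elim: n => // n IH in A IA *; rewrite ltnS => hn.
have [C hC] := cart_ex arr spl (hb _ IA).
case: (boolP [forall i, 0 <= dotv y (row i A)]) => [/forallP h | ].
  by exists A.
rewrite negb_forall => /existsP [i]; rewrite -ltNge => hi.
apply: (IH (cross C i A)); first exact: hs.
exact: leq_trans (separating_cross (hb _ IA) hC hi) hn.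
Qed.

Section Split.
Variable P : pred 'I_4.

(** Suppose a root is positive on both parts. Choose [y] equal to 1 on the base vectors in [P] and
    so negative on the others that the root is negative at [y]. The walk towards [y] crosses only
    walls outside [P] and leaves the base vectors in [P] alone, so the root keeps its coefficient at
    [i] and stays a nonnegative combination; at the end this makes it nonnegative at [y]. *)
Lemma disconnected_roots A C : base s A -> Cart s A C ->
  (forall i j, P i -> ~~ P j -> C i j = 0) ->
  forall u i j, isroot s (u *m A) -> P i -> ~~ P j -> u 0 i != 0 -> u 0 j = 0.
Proof.
move=> bA hC hP.
suff main u i j : isroot s (u *m A) -> P i -> ~~ P j -> 0 < u 0 i -> ~~ (0 < u 0 j).
  move=> u i j hr Pi Pj hi; have [_ _ hA] := bA.
  case: (hA _ hr) => h.
    have hi' : 0 < u 0 i by rewrite lt_neqAle eq_sym hi h.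
    by apply/eqP; rewrite eq_le h andbT leNgt (main u i j).
  have hi' : 0 < (- u) 0 i by rewrite mxE oppr_gt0 lt_neqAle hi h.
  have hr' : isroot s (- u *m A) by rewrite mulNmx; apply: isrootN.
  have := main _ _ _ hr' Pi Pj hi'; rewrite mxE oppr_gt0 -leNgt => h2.
  by apply/eqP; rewrite eq_le h h2.
move=> hr Pi Pj hi; apply/negP => hj.
have [uA rA hA] := bA.
have u0 m : 0 <= u 0 m.
  by case: (hA _ hr) => // h; have := h i; rewrite leNgt hi.
pose S := \sum_(m | P m) u 0 m; pose T := (1 + S) / u 0 j.
have S0 : 0 <= S by apply: sumr_ge0.
have T0 : 0 < T by rewrite divr_gt0 // ltr_pwDl.
have [y hy] := point_of_values (\row_m (if P m then 1 else - T)) uA.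
have hneg : dotv y (u *m A) < 0.
  rewrite dotv_mulmx (bigID P) /= [X in X + _](_ : _ = S); last first.
    by apply: eq_bigr => m Pm; rewrite hy mxE Pm mulr1.
  rewrite (bigD1 j) //= hy mxE (negPf Pj).
  have : \sum_(m | ~~ P m && (m != j)) u 0 m * dotv y (row m A) <= 0.
    apply: sumr_le0 => m /andP [Pm _]; rewrite hy mxE (negPf Pm) mulrN oppr_le0.
    by rewrite mulr_ge0 // ltW.
  have -> : u 0 j * - T = - (1 + S) by rewrite mulrN mulrC divfK // gt_eqF.
  set Z := \sum_(m | _) _; move=> hZ; lra.
(* The last clause, that the two parts stay unconnected, is what keeps the base vectors in [P] fixed
   at the next crossing. *)
pose Inv B := [/\ base s B, forall m, P m -> row m B = row m A,
  forall m, ~~ P m -> exists2 w : 'rV_4, (forall l, P l -> w 0 l = 0) & row m B = w *m A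
  & forall C', Cart s B C' -> forall a b, P a -> ~~ P b -> C' a b = 0].
have IA : Inv A.
  split=> // [m Pm | C' hC' a b Pa Pb].
    exists (delta_mx 0 m); last by rewrite rowE.
    by move=> l Pl; rewrite mxE eqxx /=; case: eqP => // e; rewrite -e Pl in Pm.
  have hab : a != b by apply: contraNneq Pb => <-.
  by rewrite (cart_uniq (hC' _ _ hab) (hC _ _ hab)) hP.
have [||B [bB r1 r2 _] hB] := walk IA (y := y); first by move=> B [].
  move=> B C' m [bB r1 r2 hc] hC' hm.
  have Pm : ~~ P m.
    by apply/negP => Pm; move: hm; rewrite r1 // hy mxE Pm ltr10.
  have bE := cross_base arr spl m bB hC'.
  have hc0 a : P a -> C' m a = 0.
    move=> Pa; have ham : a != m by apply: contraNneq Pm => <-.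
    by apply: (cart_eq0_sym bB hC' ham); apply: hc.
  split=> // [a Pa | a Pa | C2 hC2 a b Pa Pb].
  - have ham : a != m by apply: contraNneq Pm => <-.
    by rewrite row_cross_neq // hc0 // scale0r addr0 r1.
  - have [wm wm0 em] := r2 _ Pm; have [wa wa0 ea] := r2 _ Pa.
    rewrite row_cross; case: eqP => _.
      by exists (- wm); [move=> l Pl; rewrite mxE wm0 ?oppr0 | rewrite mulNmx em].
    exists (wa + C' m a *: wm); last by rewrite mulmxDl -scalemxAl ea em.
    by move=> l Pl; rewrite !mxE wm0 ?wa0 // mulr0 addr0.
  have ham : a != m by apply: contraNneq Pm => <-.
  have hab : a != b by apply: contraNneq Pb => <-.
  case: (eqVneq b m) => [-> | hbm].
    have hma : m != a by rewrite eq_sym.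
    apply: (cart_eq0_sym bE hC2 hma).
    by rewrite (cart_uniq (hC2 _ _ hma) (cart_cross_back bB hC' hma)) hc0.
  have [hr2 _] := hC2 _ _ hab; move: hr2.
  rewrite !row_cross_neq // (hc0 a Pa) scale0r addr0.
  (* A nonzero new entry [C2 a b] would give a root over [B] involving [a], [b] and possibly [m],
     although [a] is joined to neither [b] nor [m]. *)
  pose z := delta_mx 0 b + C' m b *: delta_mx 0 m + C2 a b *: delta_mx 0 a : 'rV[R]_4.
  have -> : row b B + C' m b *: row m B + C2 a b *: row a B = z *m B.
    by rewrite !mulmxDl -!scalemxAl -!rowE.
  move=> hz; apply/eqP/negP => /negP hn.
  have za : z 0 a = C2 a b.
    by rewrite !mxE !eqxx (negPf ham) (negPf hab) /= mulr0 !add0r mulr1.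
  have zb : z 0 b = 1.
    by rewrite !mxE !eqxx (negPf hbm) (eq_sym b a) (negPf hab) /= !mulr0 !addr0.
  have hsup l : l != a -> z 0 l != 0 -> C' a l = 0.
    move=> hla; rewrite !mxE eqxx (negPf hla) /= mulr0 addr0.
    case: (eqVneq l b) => [-> _ | _]; first exact: hc.
    case: (eqVneq l m) => [-> _ | _]; first exact: hc.
    by rewrite mulr0 addr0 eqxx.
  have hba : b != a by rewrite eq_sym.
  have := isolated_root bB hC' hz hsup _ hba; rewrite za zb => /(_ hn) /eqP.
  by rewrite oner_eq0.
have [uB rB hBB] := bB.
have [u' eu'] := root_coords (u *m A) uB.
have ui : u 0 i = u' 0 i.
  have : u = \sum_m u' 0 m *: (row m B *m invmx A).
    apply: (row_comb_inj uA); rewrite eu' mulmx_sum_row mulmx_suml.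
    by apply: eq_bigr => m _; rewrite -scalemxAl mulmxKV.
  move=> ->; rewrite summxE (bigD1 i) //= big1 => [|m hm].
    by rewrite r1 // rowE mulmxK // !mxE !eqxx addr0 mulr1.
  rewrite mxE; case: (boolP (P m)) => Pm.
    by rewrite r1 // rowE mulmxK // !mxE eq_sym (negPf hm) andbF mulr0.
  by have [w w0 ->] := r2 _ Pm; rewrite mulmxK // w0 ?mulr0.
move: hneg; rewrite ltNge => /negP; apply; rewrite eu' dotv_mulmx.
apply: sumr_ge0 => m _; rewrite mulr_ge0 //.
move: hr; rewrite eu' => /hBB [] // h; have := h i; rewrite -ui leNgt hi //.
Qed.

(** [V Q] is spanned by the vectors of the basis dual to [A] with index in [Q]. A normal supported
    on one part kills the dual vectors of the other, so its hyperplane contains that summand, and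
    the modular law splits it. *)
Lemma split_reducible A i0 j0 : base s A -> P i0 -> ~~ P j0 ->
  (forall u i j, isroot s (u *m A) -> P i -> ~~ P j -> u 0 i != 0 -> u 0 j = 0) ->
  reducible s.
Proof.
move=> [uA _ _] Pi Pj hs; set D := invmx A^T.
have uAT : A^T \in unitmx by rewrite unitmx_tr.
pose E (Q : pred 'I_4) : 'M[R]_4 := diag_mx (\row_i (Q i)%:R).
pose V Q := E Q *m D.
have VA Q : V Q *m A^T = E Q by rewrite mulmxKV.
have EE : E P *m E (predC P) = 0.
  rewrite mulmx_diag; apply/matrixP => i j; rewrite !mxE /=.
  by case: (P i); rewrite ?mulr0 ?mul0r mul0rn.
have ED : E P + E (predC P) = 1%:M.
  apply/matrixP => i j; rewrite !mxE /=; case: eqP => _; last by rewrite !mulr0n addr0.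
  by case: (P i); rewrite ?addr0 ?add0r.
have E2 : E (predC P) *m E (predC P) = E (predC P).
  rewrite mulmx_diag; apply/matrixP => i j; rewrite !mxE /=.
  by case: (P i); rewrite ?mulr0 ?mul0r ?mulr1.
have Vn (Q : pred 'I_4) i : Q i -> V Q != 0.
  move=> Qi; apply: contraTneq isT => h; have := VA Q; rewrite h mul0mx => /matrixP /(_ i i).
  by rewrite !mxE Qi eqxx => /eqP; rewrite eq_sym oner_eq0.
have Vsum : (V P + V (predC P) :=: 1%:M)%MS.
  apply/eqmxP; rewrite submx1 /= (_ : 1%:M = A^T *m (V P + V (predC P))).
    apply: submx_trans (submxMl _ _) _; exact: addmx_sub_adds.
  by rewrite -mulmxDl ED mul1mx mulmxV.
have Vcap : (V P :&: V (predC P))%MS = 0.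
  apply/eqP/rowV0P => x; rewrite sub_capmx => /andP [/submxP [a ea] /submxP [b eb]].
  have h1 : x *m A^T = a *m E P by rewrite ea -mulmxA VA.
  have h2 : x *m A^T = b *m E (predC P) by rewrite eb -mulmxA VA.
  have : x *m A^T *m E (predC P) = 0 by rewrite h1 -mulmxA EE mulmx0.
  rewrite h2 -mulmxA E2 -h2 => /(congr1 (mulmx^~ D)).
  by rewrite mulmxK // mul0mx.
have rk : (\rank (V P) + \rank (V (predC P)))%N = 4%N.
  by rewrite -mxrank_sum_cap Vcap mxrank0 addn0 Vsum mxrank1.
have side (V1 V2 : 'M[R]_4) (k : 'I_(size s)) : (V1 + V2 :=: 1%:M)%MS ->
   (V1 :&: V2)%MS = 0 -> (\rank V1 + \rank V2)%N = 4%N -> (V2 <= hyp s k)%MS ->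
   exists H1 : 'M[R]_4, [/\ (H1 <= V1)%MS, \rank H1 = (\rank V1).-1
                                  & (hyp s k == H1 + V2)%MS].
  move=> h1 h2 h3 h4; exists (V1 :&: hyp s k)%MS.
  have e : (hyp s k :=: (V1 :&: hyp s k) + V2)%MS.
    rewrite addsmxC; apply: eqmx_sym; apply: eqmx_trans (matrix_modl V1 h4) _.
    rewrite addsmxC; apply: eqmx_trans (cap_eqmx h1 (eqmx_refl _)) _.
    by rewrite cap1mx.
  split; first exact: capmxSl; last exact/eqmxP.
  have := mxrank_sum_cap (V1 :&: hyp s k)%MS V2.
  rewrite -e (rank_hyp arr) [X in (_ + \rank X)%N](_ : _ = 0) ?mxrank0 => [h5 | ].
    by move: h5 h3; rewrite addn0; case: (\rank V1) => [|n] /=; lia.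
  apply/eqP; rewrite -submx0 -h2 capmxS //; exact: capmxSl.
exists (V P), (V (predC P)); split=> //; [exact: Vn Pi|exact: (Vn (predC P) j0)|exact/eqmxP|].
move=> k hk; pose k' := Ordinal hk.
have hsub (Q : pred 'I_4) : (forall i, Q i -> (s`_k *m invmx A) 0 i = 0) -> (V Q <= hyp s k)%MS.
  move=> h; apply/sub_kermxP; rewrite -(mulmxKV uA s`_k) trmx_mul mulmxA VA.
  apply/matrixP => i j; rewrite mul_diag_mx !mxE; case: (boolP (Q i)) => Qi; last by rewrite mul0r.
  by rewrite -[RHS](mulr0 1) -[in RHS](h i Qi) mxE ord1.
have hr : isroot s (s`_k *m invmx A *m A).
  by rewrite mulmxKV //; exists k', 1; rewrite ?oner_eq0 ?scale1r.
case: (EM (exists2 i, P i & (s`_k *m invmx A) 0 i != 0)) => [[i Pi' hi] | hn].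
  left; apply: (side _ _ k') => //; apply: hsub => j Qj.
  exact: hs hr Pi' Qj hi.
right; have h : (V P <= hyp s k)%MS.
  apply: hsub => i Qi; apply/eqP; apply: contrapT => /negP h; apply: hn; by exists i.
have [||||H [h1 h2 /eqmxP h3]] := side (V (predC P)) (V P) k' => //.
- by rewrite addsmxC.
- by rewrite capmxC.
- by rewrite addnC.
by exists H; split=> //; apply/eqmxP; rewrite addsmxC.
Qed.

End Split.

Lemma irreducible_connected A C (P : pred 'I_4) i0 j0 : irreducible s ->
  base s A -> Cart s A C -> P i0 -> ~~ P j0 ->
  exists i j, [/\ P i, ~~ P j & C i j != 0].
Proof.
move=> irr bA hC Pi Pj; apply: contrapT => h; apply: irr.
apply: (split_reducible bA Pi Pj); apply: (disconnected_roots bA hC) => i j Qi Qj.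
by apply/eqP; apply: contrapT => /negP hn; apply: h; exists i, j.
Qed.

End Walks.

(** * Localizations of rank three *)

Lemma mem_flat (R : realType) (s : seq 'rV[R]_4) (J : {set 'I_(size s)}) (x : 'rV[R]_4) :
  (x <= flat J)%MS <-> forall m, m \in J -> dotv x s`_m = 0.
Proof.
rewrite /flat genmxE; set M := (\matrix_(i, k) _).
have e m : (x *m M^T) 0 m = if m \in J then dotv x s`_m else 0.
  rewrite mxE; case: ifP => hm.
    by rewrite /dotv mxE; apply: eq_bigr => k _; rewrite !mxE hm.
  by rewrite big1 // => k _; rewrite !mxE hm mulr0.
split=> [/sub_kermxP h m hm | h].
  by have := e m; rewrite h mxE hm.
by apply/sub_kermxP/rowP => m; rewrite e mxE; case: ifP => // /h.
Qed.

Lemma fourth_index (i j k : 'I_4) : i != j -> j != k -> i != k ->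
  exists2 l, [/\ l != i, l != j & l != k] & forall m, m != l -> [\/ m = i, m = j | m = k].
Proof.
move=> hij hjk hik.
have h1 : (i != j :> nat) && (j != k :> nat) && (i != k :> nat).
  by rewrite -!val_eqE /= in hij hjk hik *; rewrite hij hjk hik.
have [[ti tj] tk] := (ltn_ord i, ltn_ord j, ltn_ord k).
(* The four indices sum to 6. *)
have hl : (6 - (i + j + k) < 4)%N by lia.
exists (Ordinal hl); first by split; rewrite -val_eqE /=; lia.
move=> m; rewrite -val_eqE /= => hm; have tm := ltn_ord m.
have : (m == i :> nat) || (m == j :> nat) || (m == k :> nat) by lia.
by case/orP => [/orP [] |] /eqP /val_inj ->; [constructor 1|constructor 2|constructor 3].
Qed.

Section Triples.
Variables (R : realType) (s : seq 'rV[R]_4).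
Hypotheses (arr : is_arrangement s) (spl : simplicial s) (m6 : mA s = 6%N).
Implicit Types (x y u v : 'rV[R]_4) (B C D : 'M[R]_4) (i j k l : 'I_4).

(** The three base vectors other than the [l]-th cut out the vertex spanned by the dual vector [d];
    a hyperplane contains it exactly when the [l]-th coefficient of its normal vanishes. *)
Lemma vertex_weight B l : base s B ->
  (#|[set m : 'I_(size s) | ((s`_m *m invmx B) 0 l == 0)%R]| <= 6)%N.
Proof.
move=> [uB rB _].
have [e he] := fin_all_exists rB.
pose J := [set e m | m in [pred m | m != l]].
have uBT : B^T \in unitmx by rewrite unitmx_tr.
pose d := row l (invmx B^T).
have dB m : dotv d (row m B) = (m == l)%:R.
  by rewrite dotv_row /d -row_mul mulVmx // !mxE eq_sym.
have rowJ x : (x <= flat J)%MS <-> forall m, m != l -> dotv x (row m B) = 0.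
  rewrite mem_flat; split=> h m hm.
    by have [t _ ->] := he m; rewrite dotvZr h ?mulr0 // imset_f.
  have [k hk ->] := imsetP hm; have [t ht ek] := he k.
  have := h k hk; rewrite ek dotvZr => /eqP; rewrite mulf_eq0 (negPf ht) => /eqP //.
have fd : (flat J :=: d)%MS.
  apply/eqmxP/andP; split; last first.
    by apply/rowJ => m hm; rewrite dB (negPf hm).
  apply/row_subP => r; have /rowJ := row_sub r (flat J); set x := row r _ => hx.
  apply/submxP; exists (dotv x (row l B))%:M.
  rewrite mul_scalar_mx; apply: (@row_comb_inj R (invmx (invmx B^T))).
    by rewrite unitmx_inv unitmx_inv.
  rewrite invmxK; apply/rowP => m; rewrite -dotv_row -scalemxAl mxE -dotv_row dB.
  by case: eqP => [-> | /eqP /hx ->]; rewrite ?mulr1 ?mulr0.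
have rd : \rank (flat J) = 1%N.
  rewrite fd rank_rV; suff -> : d != 0 by [].
  apply: contraTneq isT => h; have := dB l; rewrite h eqxx /dotv mul0mx mxE => /eqP.
  by rewrite eq_sym oner_eq0.
have fJ : flat J \in flats s by rewrite mem_undup map_f // mem_enum.
have : (weight s (flat J) <= 6)%N.
  by rewrite -m6 /mA; apply: leq_bigmax_seq => //; rewrite rd.
apply: leq_trans; rewrite subset_leq_card //; apply/subsetP => m; rewrite !inE => /eqP h0.
rewrite fd mem_hyp -(mulmxKV uB s`_m) dotv_mulmx big1 // => j _; rewrite dB.
by case: eqP => [-> | _]; rewrite ?h0 ?mul0r ?mulr0.
Qed.

Definition tri B i j k (a b c : R) := a *: row i B + b *: row j B + c *: row k B.

Lemma tri12 B i j k a b c : tri B i j k a b c = tri B j i k b a c.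
Proof. by rewrite /tri [a *: _ + _]addrC. Qed.

Lemma tri23 B i j k a b c : tri B i j k a b c = tri B i k j a c b.
Proof. by rewrite /tri addrAC. Qed.

Lemma tri13 B i j k a b c : tri B i j k a b c = tri B k j i c b a.
Proof. by rewrite tri12 tri23 tri12. Qed.

Lemma tri_cross B C i j k a b c : j != i -> k != i ->
  tri (cross C i B) i j k a b c = tri B i j k (- a + C i j * b + C i k * c) b c.
Proof.
move=> hj hk; rewrite /tri row_cross_id !row_cross_neq // !scalerDr !scalerA !scalerDl.
rewrite scalerN -scaleNr [b * _]mulrC [c * _]mulrC -!addrA; congr (_ + _).
rewrite addrCA; congr (_ + _).
by rewrite [LHS]addrA [LHS]addrC.
Qed.

Lemma cart_tri B C i j k : Cart s B C -> i != j -> isroot s (tri B i j k (C i j) 1 0).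
Proof. by move=> hC hij; rewrite /tri scale1r scale0r addr0 addrC; case: (hC _ _ hij). Qed.

(** The support of a coefficient triple. *)
Definition nzp (p : R * R * R) := (p.1.1 != 0, p.1.2 != 0, p.2 != 0).
Definition trip B i j k (p : R * R * R) := tri B i j k p.1.1 p.1.2 p.2.

Section Distinct.
Variables i j k : 'I_4.
Hypotheses (hij : i != j) (hjk : j != k) (hik : i != k).
Let hji : j != i. Proof. by rewrite eq_sym. Qed.
Let hkj : k != j. Proof. by rewrite eq_sym. Qed.
Let hki : k != i. Proof. by rewrite eq_sym. Qed.

Lemma tri_coord B a b c : B \in unitmx ->
  [/\ (tri B i j k a b c *m invmx B) 0 i = a, (tri B i j k a b c *m invmx B) 0 j = b,
      (tri B i j k a b c *m invmx B) 0 k = c &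
      forall l, l != i -> l != j -> l != k -> (tri B i j k a b c *m invmx B) 0 l = 0].
Proof.
move=> uB; rewrite /tri !mulmxDl -!scalemxAl !rowE !mulmxK //.
split=> [|||l hl1 hl2 hl3]; rewrite !mxE ?eqxx /=.
- by rewrite (negPf hij) (negPf hik) /= !mulr0 mulr1 !addr0.
- by rewrite (negPf hji) (negPf hjk) /= !mulr0 mulr1 add0r addr0.
- by rewrite (negPf hki) (negPf hkj) /= !mulr0 mulr1 !add0r.
by rewrite (negPf hl1) (negPf hl2) (negPf hl3) /= !mulr0 !addr0.
Qed.

Lemma tri_scale B a b c a' b' c' t : B \in unitmx ->
  tri B i j k a b c = t *: tri B i j k a' b' c' -> [/\ a = t * a', b = t * b' & c = t * c'].
Proof.
move=> uB e.
have [e1 e2 e3 _] := tri_coord a b c uB; have [f1 f2 f3 _] := tri_coord a' b' c' uB.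
have h l : (tri B i j k a b c *m invmx B) 0 l = t * (tri B i j k a' b' c' *m invmx B) 0 l.
  by rewrite e -scalemxAl mxE.
by split; [rewrite -e1 h f1 | rewrite -e2 h f2 | rewrite -e3 h f3].
Qed.

(** Pigeonhole: at most six hyperplanes pass through the vertex and [L] shows six supports, so the
    map from these hyperplanes to supports is injective with image the supports of [L]. *)
Lemma six_patterns B (L : seq (R * R * R)) : base s B ->
  (forall p, p \in L -> isroot s (trip B i j k p)) ->
  uniq (map nzp L) -> size L = 6%N ->
  (forall p q, isroot s (trip B i j k p) -> isroot s (trip B i j k q) ->
     nzp p = nzp q -> exists t, trip B i j k p = t *: trip B i j k q) /\
  (forall p, isroot s (trip B i j k p) -> nzp p \in map nzp L).
Proof.
move=> bB hL uL sL; have [uB _ _] := bB.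
have [l [hli hlj hlk] hl] := fourth_index hij hjk hik.
pose Z := [set m : 'I_(size s) | (s`_m *m invmx B) 0 l == 0].
pose f (m : 'I_(size s)) := nzp ((s`_m *m invmx B) 0 i, (s`_m *m invmx B) 0 j, (s`_m *m invmx B) 0 k).
have rt p : isroot s (trip B i j k p) ->
   exists2 m, m \in Z & f m = nzp p /\ exists2 t, t != 0 & trip B i j k p = t *: s`_m.
  move=> [m [t ht e]]; exists m.
    rewrite inE; have [_ _ _ /(_ l hli hlj hlk)] := tri_coord p.1.1 p.1.2 p.2 uB.
    rewrite -/(trip _ _ _ _ _) e -scalemxAl mxE => /eqP.
    by rewrite mulf_eq0 (negPf ht).
  split; last by exists t.
  have [] := tri_coord p.1.1 p.1.2 p.2 uB.
  have sc (X : 'rV[R]_4) r : (t *: X) 0 r = t * X 0 r by rewrite mxE.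
  rewrite -/(trip _ _ _ _ _) e -scalemxAl !sc /f /nzp /= => <- <- <- _.
  by rewrite !mulf_eq0 (negPf ht).
have cZ : (#|Z| <= 6)%N by apply: vertex_weight.
have sub (K : seq (bool * bool * bool)) : uniq K -> (forall z, z \in K -> z \in f @: Z) -> (size K <= #|f @: Z|)%N.
  move=> uK hK; rewrite cardE; apply: uniq_leq_size => // z /hK.
  by rewrite mem_enum.
have inL z : z \in map nzp L -> z \in f @: Z.
  move=> /mapP [p pL ->]; have [m mZ [<- _]] := rt _ (hL _ pL); exact: imset_f.
have c6 : (6 <= #|f @: Z|)%N by rewrite -sL -(size_map nzp); apply: sub.
have inj : {in Z &, injective f}.
  by apply/imset_injP/eqP/anti_leq; rewrite leq_imset_card (leq_trans cZ).
split=> [p q hp hq epq | p hp].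
  have [m mZ [fm [t ht et]]] := rt _ hp; have [m' mZ' [fm' [t' ht' et']]] := rt _ hq.
  have em : m = m' by apply: inj => //; rewrite fm fm'.
  exists (t / t'); rewrite et et' em scalerA divfK //.
apply: contraT => hn.
have : (7 <= #|f @: Z|)%N.
  rewrite -sL -(size_map nzp); apply: (sub (nzp p :: map nzp L)) => /=.
    by rewrite hn.
  move=> z; rewrite inE => /orP [/eqP -> | /inL //].
  by have [m mZ [<- _]] := rt _ hp; exact: imset_f.
by move=> h; have := leq_trans h (leq_trans (leq_imset_card _ _) cZ).
Qed.

Lemma isolated_tri B C a b c : base s B -> Cart s B C -> C k i = 0 -> C k j = 0 ->
  isroot s (tri B i j k a b c) -> c != 0 -> a = 0 /\ b = 0.
Proof.
move=> bB hC hi hj hr hc; have [uB _ _] := bB.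
have [e1 e2 e3 e4] := tri_coord a b c uB.
have hz : isroot s (tri B i j k a b c *m invmx B *m B) by rewrite mulmxKV.
have h l : l != k -> (tri B i j k a b c *m invmx B) 0 l = 0.
  apply: (isolated_root arr spl bB hC hz); last by rewrite e3.
  move=> m hmk; case: (eqVneq m i) => [-> // | hmi]; case: (eqVneq m j) => [-> // | hmj].
  by rewrite e4 // eqxx.
by split; [rewrite -e1 h | rewrite -e2 h].
Qed.

Lemma row_tri1 B : base s B -> isroot s (tri B i j k 1 0 0).
Proof. by move=> [_ h _]; rewrite /tri scale1r !scale0r !addr0. Qed.
Lemma row_tri2 B : base s B -> isroot s (tri B i j k 0 1 0).
Proof. by move=> [_ h _]; rewrite /tri scale1r !scale0r addr0 add0r. Qed.
Lemma row_tri3 B : base s B -> isroot s (tri B i j k 0 0 1).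
Proof. by move=> [_ h _]; rewrite /tri scale1r !scale0r !add0r. Qed.

Lemma cart_tri23 B C : Cart s B C -> isroot s (tri B i j k 0 (C j k) 1).
Proof. by move=> hC; rewrite tri12 tri23; apply: cart_tri. Qed.
Lemma cart_tri13 B C : Cart s B C -> isroot s (tri B i j k (C i k) 0 1).
Proof. by move=> hC; rewrite tri23; apply: cart_tri. Qed.

Lemma cart_cross_same B C C' : base s B -> Cart s B C -> Cart s (cross C i B) C' ->
  C' i j = C i j.
Proof.
by move=> bB hC hC'; apply: cart_uniq (hC' _ _ hij) (cart_cross_back bB hC hij).
Qed.

End Distinct.

(** A triangle already provides the six supports of size one and two, so no root has full support.
    This destroys the edge [j k] after crossing [i] and leaves [k] isolated after crossing [j] as
    well; but over that last base the old [row k B] still involves [i] and [j]. *)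
Lemma no_triangle B C i j k : i != j -> j != k -> i != k ->
  base s B -> Cart s B C -> C i j != 0 -> C j k != 0 -> C i k = 0.
Proof.
move=> hij hjk hik bB hC cij cjk; apply/eqP/negP => /negP cik.
have [hji hkj hki] : [/\ j != i, k != j & k != i] by split; rewrite eq_sym.
have [uB _ _] := bB.
have g0 a b : a != b -> 0 <= C a b by apply: (cart_ge0 bB hC).
pose L : seq (R * R * R) := [:: (1, 0, 0); (0, 1, 0); (0, 0, 1); (C i j, 1, 0); (0, C j k, 1); (C i k, 0, 1)].
have [] := @six_patterns i j k hij hjk hik B L bB.
- move=> p; rewrite !inE; do ![case/orP]; move/eqP ->; rewrite /trip /=;
    [exact: row_tri1|exact: row_tri2|exact: row_tri3|exact: cart_tri|exact: cart_tri23|exact: cart_tri13].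
- by rewrite /= /nzp /= !eqxx !oner_eq0 cij cjk cik.
- by [].
move=> prop pat.
have nofull a b c : isroot s (tri B i j k a b c) -> a != 0 -> b != 0 -> c == 0.
  move=> hr ha hb; have := pat (a, b, c) hr.
  by rewrite /= /nzp /= !eqxx !oner_eq0 cij cjk cik ha hb; case: (c == 0).
set B' := cross C i B; have bB' : base s B' by apply: cross_base.
have [C' hC'] := cart_ex arr spl bB'.
have eij : C' i j = C i j by apply: cart_cross_same hC hC'.
have eik : C' i k = C i k by apply: cart_cross_same hC hC'.
have cjk' : C' j k = 0.
  apply/eqP/negP => /negP hn.
  have := cart_tri23 i hjk hC'; rewrite tri_cross // oppr0 add0r mulr1.
  move=> /nofull; rewrite oner_eq0 => h.
  suff : false by []; apply: h => //; rewrite gt_eqF //.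
  rewrite ltr_wpDl ?mulr_ge0 ?g0 //; first exact: (cart_ge0 bB' hC').
  by rewrite lt_neqAle eq_sym cik g0.
have cji' : C' j i != 0.
  apply/eqP => h; case/eqP: cij; rewrite -eij; exact: (cart_eq0_sym bB' hC' hji).
have pr : C i j * C' j i = 1.
  apply/eqP/negP => /negP hn.
  have := cart_tri k hC' hji; rewrite tri12 tri_cross // mulr0 addr0 => hr.
  have [] := prop (- 1 + C i j * C' j i, C' j i, 0) (C i j, 1, 0) hr (cart_tri k hC hij).
    rewrite /nzp /= eqxx cij cji' oner_eq0 addrC subr_eq0 hn //.
  move=> t /(tri_scale hij hjk hik uB) [/= h1 h2 _].
  by move: h1; rewrite h2 mulr1; lra.
set B2 := cross C' j B'; have bB2 : base s B2 by apply: cross_base.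
have [C2 hC2] := cart_ex arr spl bB2.
have cjk2 : C2 j k = 0 by rewrite -cjk'; apply: cart_cross_same hC' hC2.
have tri2 a b c : tri B2 i j k a b c = tri B' i j k a (- b + C' j i * a + C' j k * c) c.
  by rewrite tri12 tri_cross // tri12.
have cik2 : C2 i k = 0.
  apply/eqP/negP => /negP hn.
  have := cart_tri13 j hik hC2; rewrite tri2 tri_cross // cjk' => /nofull.
  rewrite oner_eq0 => h; suff : false by []; apply: h.
    have -> : - C2 i k + C i j * (- 0 + C' j i * C2 i k + 0 * 1) + C i k * 1 =
       (C i j * C' j i - 1) * C2 i k + C i k by ring.
    by rewrite pr subrr mul0r add0r.
  by rewrite oppr0 add0r mul0r addr0 mulf_neq0.
have rk : isroot s (tri B2 i j k (C i k) (C' j i * C i k) 1).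
  rewrite tri2 tri_cross // cjk'.
  have -> : - (C' j i * C i k) + C' j i * C i k + 0 * 1 = 0 by ring.
  have -> : - C i k + C i j * 0 + C i k * 1 = 0 by ring.
  exact: row_tri3.
have [] := isolated_tri hij hjk hik bB2 hC2 _ _ rk (oner_neq0 _).
- exact: (cart_eq0_sym bB2 hC2 hik).
- exact: (cart_eq0_sym bB2 hC2 hjk).
by move=> h; rewrite h eqxx in cik.
Qed.

Section Path.
Variables (B C : 'M[R]_4) (i j k : 'I_4).
Hypotheses (bB : base s B) (hC : Cart s B C).
Hypotheses (hij : i != j) (hjk : j != k) (hik : i != k).
Hypotheses (cij : C i j != 0) (cjk : C j k != 0).
Let hji : j != i. Proof. by rewrite eq_sym. Qed.
Let hkj : k != j. Proof. by rewrite eq_sym. Qed.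
Let hki : k != i. Proof. by rewrite eq_sym. Qed.

(** The root in the plane of [j] and [k] seen from beyond wall [i] becomes, over [B], the analogue
    of the highest root of A_3. Were [C' j k] zero, [k] would be isolated there, against the old
    root on the edge [j k]. *)
Lemma path_theta C' : Cart s (cross C i B) C' ->
  C' j k != 0 /\ isroot s (tri B i j k (C i j * C' j k) (C' j k) 1).
Proof.
move=> hC'; have cik : C i k = 0 by apply: no_triangle hC cij cjk.
have bB' : base s (cross C i B) by apply: cross_base.
have cki' : C' k i = 0.
  apply: (cart_eq0_sym bB' hC' hik); rewrite -cik; exact: cart_cross_same hC hC'.
have n0 : C' j k != 0.
  apply/eqP => h0; have ckj' : C' k j = 0 := cart_eq0_sym bB' hC' hjk h0.
  have hr : isroot s (tri (cross C i B) i j k (C i j * C j k) (C j k) 1).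
    rewrite tri_cross // cik.
    have -> : - (C i j * C j k) + C i j * C j k + 0 * 1 = 0 by ring.
    exact: cart_tri23.
  have [_ /eqP] := isolated_tri hij hjk hik bB' hC' cki' ckj' hr (oner_neq0 _).
  by rewrite (negPf cjk).
split=> //; have := cart_tri23 i hjk hC'; rewrite tri_cross // cik.
by have -> : - 0 + C i j * C' j k + 0 * 1 = C i j * C' j k by ring.
Qed.

(** The six supports are the connected subsets of the path, as for A_3. *)
Lemma path_prop p q : isroot s (trip B i j k p) -> isroot s (trip B i j k q) ->
  nzp p = nzp q -> exists t, trip B i j k p = t *: trip B i j k q.
Proof.
have [C' hC'] := cart_ex arr spl (cross_base arr spl i bB hC).
have [n0 rth] := path_theta hC'.
pose L : seq (R * R * R) := [:: (1, 0, 0); (0, 1, 0); (0, 0, 1); (C i j, 1, 0); (0, C j k, 1);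
             (C i j * C' j k, C' j k, 1)].
have [] := @six_patterns i j k hij hjk hik B L bB; last by move=> h _; apply: h.
- move=> r; rewrite !inE; do ![case/orP]; move/eqP ->; rewrite /trip //=;
    [exact: row_tri1|exact: row_tri2|exact: row_tri3|exact: cart_tri|exact: cart_tri23].
- by rewrite /= /nzp /= !eqxx !oner_eq0 cij cjk n0 mulf_neq0.
by [].
Qed.

(** The two ends of the edge give roots [(C i j, 1)] and [(1, C j i)] with the same support, hence
    proportional. *)
Lemma path_prod12 : C i j * C j i = 1.
Proof.
have [uB _ _] := bB.
have h2 : isroot s (trip B i j k (1, C j i, 0)) by rewrite /trip /= tri12; apply: cart_tri.
have cji : C j i != 0.
  by apply: contra_neq cij => h; exact: (cart_eq0_sym bB hC hji).
have [|t] := path_prop h2 (cart_tri k hC hij : isroot s (trip B i j k (C i j, 1, 0))).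
  by rewrite /nzp /= cij cji !oner_eq0.
move=> /(tri_scale hij hjk hik uB) [/= h3 h4 _].
by rewrite h4 mulr1 mulrC -h3.
Qed.

Lemma path_prod23 : C j k * C k j = 1.
Proof.
have [uB _ _] := bB.
have h2 : isroot s (trip B i j k (0, 1, C k j)).
  by rewrite /trip /= tri13; apply: cart_tri.
have ckj : C k j != 0.
  by apply: contra_neq cjk => h; exact: (cart_eq0_sym bB hC hkj).
have [|t] := path_prop h2 (cart_tri23 i hjk hC : isroot s (trip B i j k (0, C j k, 1))).
  by rewrite /nzp /= cjk ckj !oner_eq0.
move=> /(tri_scale hij hjk hik uB) [/= _ h3 h4].
by rewrite h4 mulr1 mulrC -h3.
Qed.

End Path.

(* Both neighbours across the ends of the path see the highest root of the
   rank-three localization, which pins down its coordinates. *)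
Lemma path_cross_end B C C' i j k : base s B -> Cart s B C ->
  i != j -> j != k -> i != k -> C i j != 0 -> C j k != 0 ->
  Cart s (cross C i B) C' -> C' j k = C j k.
Proof.
move=> bB hC hij hjk hik cij cjk hC'; have [uB _ _] := bB.
have [hji hkj hki] : [/\ j != i, k != j & k != i] by split; rewrite eq_sym.
have cji : C j i != 0.
  by apply: contra_neq cij => h; exact: (cart_eq0_sym bB hC hji).
have ckj : C k j != 0.
  by apply: contra_neq cjk => h; exact: (cart_eq0_sym bB hC hkj).
have [x0 r1] := path_theta bB hC hij hjk hik cij cjk hC'.
have [C2 hC2] := cart_ex arr spl (cross_base arr spl k bB hC).
have [y0 r2] := path_theta bB hC hkj hji hki ckj cji hC2.
rewrite tri13 in r2.
have [|t] := path_prop bB hC hij hjk hik cij cjk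
   (p := (C i j * C' j k, C' j k, 1)) (q := (1, C2 j i, C k j * C2 j i)) r1 r2.
  by rewrite /nzp /= !mulf_neq0 // x0 y0 !oner_eq0.
move=> /(tri_scale hij hjk hik uB) [/= _ h1 h2].
have h3 := path_prod23 bB hC hij hjk hik cij cjk.
apply: (mulIf ckj); rewrite h3 h1 h2; ring.
Qed.

(** By connectedness some third node is joined to the edge, which makes a path of three nodes. *)
Lemma edge_prod B C i j : irreducible s -> base s B -> Cart s B C -> i != j ->
  C i j != 0 -> C i j * C j i = 1.
Proof.
move=> irr bB hC hij cij; have hji : j != i by rewrite eq_sym.
have cji : C j i != 0.
  by apply: contra_neq cij => h; exact: (cart_eq0_sym bB hC hji).
have [l hl] : exists l, ~~ pred2 i j l.
  case: (boolP [exists l, ~~ pred2 i j l]) => [/existsP // | ].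
  rewrite negb_exists => /forallP h.
  have : (#|'I_4| <= #|pred2 i j|)%N.
    by apply: subset_leq_card; apply/subsetP => x _; rewrite -[_ \in _]negbK h.
  by rewrite card_ord card2 hij.
have [|a [b [Pa Pb cab]]] := irreducible_connected arr spl (i0 := i) irr bB hC _ hl.
  by rewrite /= eqxx.
move: Pb; rewrite /= negb_or => /andP [hbi hbj].
have [hib hjb] : i != b /\ j != b by split; rewrite eq_sym.
case/orP: Pa => /eqP ea; rewrite ea in cab.
  by rewrite mulrC; apply: (path_prod12 bB hC hji hib hjb).
by apply: (path_prod12 bB hC hij hjb hib).
Qed.

(** Row [i] is kept since crossing back undoes the step, and column [i] follows from the products on
    edges. Any other entry is settled in the triple [i], [p], [q]: a new edge [p q] would close a
    triangle or join an isolated node, and an old one is controlled by the path through [i], or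
    untouched if [i] is joined to neither. *)
Lemma Cart_cross B C i : irreducible s -> base s B -> Cart s B C ->
  Cart s (cross C i B) C.
Proof.
move=> irr bB hC.
have bB' : base s (cross C i B) by apply: cross_base.
have [C' hC'] := cart_ex arr spl bB'.
suff e p q : p != q -> C' p q = C p q by move=> p q hpq; rewrite -e //; apply: hC'.
have e1 r : i != r -> C' i r = C i r by move=> hir; apply: cart_cross_same hC hC'.
have e2 r : r != i -> C' r i = C r i.
  move=> hri; have hir : i != r by rewrite eq_sym.
  case: (eqVneq (C i r) 0) => h.
    rewrite (cart_eq0_sym bB hC hir h) (cart_eq0_sym bB' hC' hir) // e1 //.
  have h' : C' i r != 0 by rewrite e1.
  apply: (mulfI h); rewrite -{1}(e1 r hir) (edge_prod irr bB' hC' hir h').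
  by rewrite (edge_prod irr bB hC hir h).
move=> hpq; have hqp : q != p by rewrite eq_sym.
case: (eqVneq p i) => [ep | hpi]; first by rewrite ep e1 // -ep.
case: (eqVneq q i) => [-> | hqi]; first exact: e2.
have [hip hiq] : i != p /\ i != q by split; rewrite eq_sym.
case: (eqVneq (C p q) 0) => [cpq | cpq].
  rewrite cpq; apply/eqP/negP => /negP cpq'.
  have cqp : C q p = 0 := cart_eq0_sym bB hC hpq cpq.
  have := cart_tri23 i hpq hC'; rewrite tri_cross // => hr.
  case: (eqVneq (C i p) 0) => [cip | cip].
    have cpi : C p i = 0 := cart_eq0_sym bB hC hip cip.
    rewrite tri23 in hr; have [_ /eqP] := isolated_tri hiq hqp hip bB hC cpi cpq hr cpq'.
    by rewrite oner_eq0.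
  case: (eqVneq (C i q) 0) => [ciq | ciq].
    have cqi : C q i = 0 := cart_eq0_sym bB hC hiq ciq.
    have [_ h] := isolated_tri hip hpq hiq bB hC cqi cqp hr (oner_neq0 _).
    by rewrite h eqxx in cpq'.
  have cpi' : C' p i != 0.
    by apply: contra_neq cip => h; rewrite -e1 //; exact: (cart_eq0_sym bB' hC' hpi).
  have ciq' : C' i q != 0 by rewrite e1.
  by move: cpq'; rewrite (no_triangle hpi hiq hpq bB' hC' cpi' ciq') eqxx.
case: (eqVneq (C i p) 0) => [cip | cip]; last exact: path_cross_end hC _ _ _ cip cpq hC'.
have cqp : C q p != 0.
  by apply: contra_neq cpq => h; exact: (cart_eq0_sym bB hC hqp).
case: (eqVneq (C i q) 0) => [ciq | ciq].
  apply: (cart_uniq _ (hC _ _ hpq)); have := hC' _ _ hpq.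
  by rewrite /cart !row_cross_neq // cip ciq !scale0r !addr0.
have e3 : C' q p = C q p := path_cross_end bB hC hiq hqp hip ciq cqp hC'.
have cqp' : C' q p != 0 by rewrite e3.
apply: (mulfI cqp); rewrite -{1}e3 (edge_prod irr bB' hC' hqp cqp').
by rewrite (edge_prod irr bB hC hqp cqp).
Qed.

End Triples.

(** * Classification of the Cartan matrix *)

(** A graph on four nodes as six bits, one per pair in the listed order; a pair off the list, such
    as a loop, gives [false]. *)
Definition adj4 (b : seq bool) (i j : nat) : bool :=
  nth false b (index (minn i j, maxn i j)
    [:: (0, 1); (0, 2); (0, 3); (1, 2); (1, 3); (2, 3)]%N).

(** These are the orderings of the four nodes, not hyperplane arrangements. *)
Definition arrangements4 : seq (seq nat) :=
  [seq l <- [seq [:: p.1; p.2; q.1; q.2] | p <- [seq (a, b) | a <- iota 0 4, b <- iota 0 4],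
     q <- [seq (a, b) | a <- iota 0 4, b <- iota 0 4]] | uniq l].

Definition same_graph (e f : nat -> nat -> bool) :=
  all (fun i => all (fun j => (i == j) || (e i j == f i j)) (iota 0 4)) (iota 0 4).

Definition pathg (i j : nat) := (i == j.+1) || (j == i.+1).
Definition starg (i j : nat) := (i == 1%N) || (j == 1%N).
Definition cycleg (i j : nat) := (i == (j.+1 %% 4)%N) || (j == (i.+1 %% 4)%N).

(** Connectedness is phrased by cuts: an edge leaves every node and every pair of nodes, and up to
    complement four nodes have no other cuts. All 64 graphs are then inspected. *)
Lemma triangle_free_connected (b : seq bool) : size b = 6%N ->
  all (fun l => ~~ [&& adj4 b (nth 0%N l 0) (nth 0%N l 1), adj4 b (nth 0%N l 1) (nth 0%N l 2)
                     & adj4 b (nth 0%N l 0) (nth 0%N l 2)]) arrangements4 ->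
  all (fun l => (adj4 b (nth 0%N l 0) (nth 0%N l 1) || adj4 b (nth 0%N l 0) (nth 0%N l 2) || adj4 b (nth 0%N l 0) (nth 0%N l 3))
    && (adj4 b (nth 0%N l 0) (nth 0%N l 2) || adj4 b (nth 0%N l 0) (nth 0%N l 3) ||
        adj4 b (nth 0%N l 1) (nth 0%N l 2) || adj4 b (nth 0%N l 1) (nth 0%N l 3))) arrangements4 ->
  has (fun l => has (same_graph (fun i j => adj4 b (nth 0%N l i) (nth 0%N l j))) [:: pathg; starg; cycleg])
    arrangements4.
Proof.
case: b => [|b0 [|b1 [|b2 [|b3 [|b4 [|b5 [|]]]]]]] // _.
by case: b0; case: b1; case: b2; case: b3; case: b4; case: b5; vm_compute.
Qed.

Lemma arrangements4P l : l \in arrangements4 ->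
  exists x0 x1 x2 x3, [/\ l = [:: x0; x1; x2; x3], uniq l, all (fun x => x < 4)%N l
     & forall j : 'I_4, val j \in l].
Proof.
have /allP h : all (fun l => [&& uniq l, size l == 4%N, all (fun x => x < 4)%N l
    & all (fun j => j \in l) (iota 0 4)]) arrangements4 by vm_compute.
move=> /h /and4P [ul /eqP sl al /allP jl].
case: l sl ul al jl {h} => [|x0 [|x1 [|x2 [|x3 [|]]]]] // _ ul al jl.
exists x0, x1, x2, x3; split=> // j; apply: jl; rewrite mem_iota /=; exact: ltn_ord.
Qed.

(** * The graph of a base, rescaling, and exclusion of large row sums *)

Section Normalize.
Variables (R : realType) (s : seq 'rV[R]_4).
Hypotheses (arr : is_arrangement s) (spl : simplicial s) (m6 : mA s = 6%N).
Hypothesis irr : irreducible s.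
Implicit Types (u v : 'rV[R]_4) (A B C : 'M[R]_4) (i j : 'I_4).

Lemma base_graph B C : base s B -> Cart s B C ->
  exists2 p : 'I_4 -> 'I_4, injective p & exists2 g, g \in [:: 0; 1; 2]%N &
    forall i j, i != j -> (C (p i) (p j) != 0) = nth pathg [:: pathg; starg; cycleg] g i j.
Proof.
move=> bB hC.
pose b := [seq C (inord x.1) (inord x.2) != 0 |
   x <- [:: (0, 1); (0, 2); (0, 3); (1, 2); (1, 3); (2, 3)]%N].
have csym (i j : 'I_4) : i != j -> (C i j != 0) = (C j i != 0).
  move=> hij; have hji : j != i by rewrite eq_sym.
  by congr (~~ _); apply/eqP/eqP => h; exact: (cart_eq0_sym bB hC _ h).
have ine (a c : nat) : (a < 4)%N -> (c < 4)%N -> a != c -> inord a != inord c :> 'I_4.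
  by move=> ha hc; apply: contra_neq => /(congr1 val); rewrite /= !inordK.
have adjE a c : (a < 4)%N -> (c < 4)%N -> a != c -> adj4 b a c = (C (inord a) (inord c) != 0).
  move=> ha hc hac; have := csym _ _ (ine _ _ ha hc hac); move: ha hc hac.
  by case: a => [|[|[|[|]]]] //; case: c => [|[|[|[|]]]] // _ _ _ /= h; rewrite ?h.
have tri l : l \in arrangements4 -> ~~ [&& adj4 b (nth 0%N l 0) (nth 0%N l 1),
     adj4 b (nth 0%N l 1) (nth 0%N l 2) & adj4 b (nth 0%N l 0) (nth 0%N l 2)].
  move=> /arrangements4P [x0 [x1 [x2 [x3 [-> /= ul al _]]]]].
  move: ul al; rewrite !inE !negb_or => /and4P [/and3P [h01 h02 _] /andP [h12 _] _ _].
  move=> /and5P [t0 t1 t2 _ _]; rewrite !adjE //; apply/negP => /and3P [c01 c12 /eqP].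
  by apply; apply: (no_triangle arr spl m6 _ _ _ bB hC c01 c12); apply: ine.
have con l : l \in arrangements4 -> (adj4 b (nth 0%N l 0) (nth 0%N l 1) || adj4 b (nth 0%N l 0) (nth 0%N l 2) || adj4 b (nth 0%N l 0) (nth 0%N l 3))
    && (adj4 b (nth 0%N l 0) (nth 0%N l 2) || adj4 b (nth 0%N l 0) (nth 0%N l 3) ||
        adj4 b (nth 0%N l 1) (nth 0%N l 2) || adj4 b (nth 0%N l 1) (nth 0%N l 3)).
  move=> /arrangements4P [x0 [x1 [x2 [x3 [-> /= ul al jl]]]]].
  move: ul al; rewrite !inE !negb_or => /and4P [/and3P [h01 h02 h03] /andP [h12 h13] h23 _].
  move=> /and5P [t0 t1 t2 t3 _].
  have io (j : 'I_4) x : val j = x -> j = inord x by move=> <-; rewrite inord_val.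
  apply/andP; split.
    have [||i [j [Pi Pj]]] := irreducible_connected arr spl (P := pred1 (inord x0))
       (i0 := inord x0) (j0 := inord x1) irr bB hC.
    - by rewrite /= eqxx.
    - by rewrite /= eq_sym; apply: ine.
    rewrite (eqP Pi); have := jl j; rewrite !inE.
    case/or4P => /eqP /io ej; rewrite ej in Pj *.
    - by move: Pj; rewrite /= eqxx.
    - by rewrite -adjE // => ->.
    - by rewrite -adjE // => ->; rewrite orbT.
    by rewrite -adjE // => ->; rewrite !orbT.
  have [||i [j [Pi Pj]]] := irreducible_connected arr spl (P := pred2 (inord x0) (inord x1))
       (i0 := inord x0) (j0 := inord x2) irr bB hC.
  - by rewrite /= eqxx.
  - by rewrite /= negb_or !(eq_sym (inord x2)) !ine.
  have := jl j; rewrite !inE.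
  case/or4P => /eqP /io ej; rewrite ej in Pj *.
  - by move: Pj; rewrite /= eqxx.
  - by move: Pj; rewrite /= eqxx orbT.
  - by case/orP: Pi => /eqP ->; rewrite -adjE // => ->; rewrite ?orbT.
  by case/orP: Pi => /eqP ->; rewrite -adjE // => ->; rewrite ?orbT.
have /hasP [l hl hg] := @triangle_free_connected b erefl (introT allP tri) (introT allP con).
have [x0 [x1 [x2 [x3 [el ul /allP al _]]]]] := arrangements4P hl.
have sl : size l = 4%N by rewrite el.
have pl (i : 'I_4) : (nth 0 l i < 4)%N by apply: al; rewrite mem_nth // sl.
have ninj (i j : 'I_4) : i != j -> nth 0%N l i != nth 0%N l j.
  by move=> hij; rewrite nth_uniq ?sl.
exists (fun i => inord (nth 0%N l i)).
  move=> i j /(congr1 val); rewrite /= !inordK // => h.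
  by apply/eqP; apply: contraT => /ninj; rewrite h eqxx.
have [g hg2 hg3] : exists2 g, g \in [:: 0; 1; 2]%N &
    same_graph (fun i j : nat => adj4 b (nth 0%N l i) (nth 0%N l j)) (nth pathg [:: pathg; starg; cycleg] g).
  by case/or4P: hg => // h; [exists 0%N | exists 1%N | exists 2%N].
exists g => // i j hij.
have in4 (m : 'I_4) : val m \in iota 0 4 by rewrite mem_iota /=; exact: ltn_ord.
have /allP /(_ _ (in4 j)) := allP hg3 _ (in4 i).
by rewrite val_eqE (negPf hij) /= => /eqP <-; rewrite adjE // ninj.
Qed.

Lemma rescale_base B C (p : 'I_4 -> 'I_4) (d : 'I_4 -> R) : base s B -> Cart s B C ->
  injective p -> (forall i, 0 < d i) ->
  base s (\matrix_i (d i *: row (p i) B)) /\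
  Cart s (\matrix_i (d i *: row (p i) B)) (\matrix_(i, j) (C (p i) (p j) * d j / d i)).
Proof.
move=> bB hC pI d0; have [uB rB hB] := bB; set A := (\matrix_i (d i *: _)).
have rA i : row i A = d i *: row (p i) B by rewrite rowK.
have dn i : d i != 0 by rewrite gt_eqF.
pose t u : 'rV[R]_4 := \row_m (u 0 (invF pI m) * d (invF pI m)).
have tE u i : t u 0 (p i) = u 0 i * d i by rewrite mxE invF_f.
have uE u : u *m A = t u *m B.
  rewrite !mulmx_sum_row [RHS](reindex_inj pI) /=; apply: eq_bigr => i _.
  by rewrite tE rA scalerA.
split; last first.
  move=> i j hij; have hp : p i != p j by rewrite (inj_eq pI).
  have [r h] := hC _ _ hp; rewrite /cart !rA mxE; split.
    rewrite scalerA divfK // [C _ _ * _]mulrC -scalerA -scalerDr.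
    exact: isrootZ.
  move=> a c a0; rewrite !scalerA => /h h1.
  have := h1 (mulr_gt0 a0 (d0 j)).
  have -> : C (p i) (p j) * d j / d i * a = C (p i) (p j) * (a * d j) / d i by ring.
  by rewrite ler_pdivlMr.
split=> [|i|u].
- rewrite -row_free_unit -kermx_eq0; apply/rowV0P => y /sub_kermxP.
  rewrite uE => h0; have h : t y = 0 by apply: (row_comb_inj uB); rewrite mul0mx.
  apply/rowP => i.
  have e0 : y 0 i * d i = 0 by rewrite -tE h mxE.
  by move/eqP: e0; rewrite mulf_eq0 (negPf (dn i)) orbF => /eqP ->; rewrite mxE.
- by rewrite rA; apply: isrootZ.
rewrite uE => /hB [h | h]; [left | right] => i; have := h (p i); rewrite tE.
  by rewrite pmulr_lge0.
by rewrite pmulr_lle0.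
Qed.

Lemma Cart_ext B C C' : Cart s B C -> (forall i j, i != j -> C i j = C' i j) -> Cart s B C'.
Proof. by move=> h e i j hij; rewrite -e //; apply: h. Qed.

Lemma Cart_uniq B C C' i j : Cart s B C -> Cart s B C' -> i != j -> C i j = C' i j.
Proof. by move=> h h' hij; apply: cart_uniq (h _ _ hij) (h' _ _ hij). Qed.

Lemma cross_ext B C C' i : (forall j, i != j -> C i j = C' i j) -> cross C i B = cross C' i B.
Proof.
move=> h; apply/row_matrixP => j; rewrite !row_cross; case: eqP => // /eqP hj.
by rewrite h // eq_sym.
Qed.

(* Walking away from a chamber the sum of the base vectors, evaluated inside
   that chamber, never decreases, so the opposite chamber is out of reach. *)
Lemma no_affine A C : base s A -> Cart s A C ->
  ~ (forall i, 2 <= \sum_(j | j != i) C i j).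
Proof.
move=> bA hC h2; have [uA _ _] := bA.
pose x0 := inner A.
pose Inv B := [/\ base s B, Cart s B C & 0 < \sum_j dotv x0 (row j B)].
have IA : Inv A.
  split=> //; rewrite (eq_bigr (fun _ => 1)) => [|i _]; last by rewrite inner_row.
  by rewrite sumr_const card_ord ltr0n.
have [||B [bB _ hs] hB] := walk arr spl IA (y := - x0); first by move=> B [].
  move=> B C' i [bB hCB hs] hC'; rewrite dotvNl oppr_lt0 => hi.
  rewrite (@cross_ext B C' C i) => [|j hij]; last exact: Cart_uniq hC' hCB hij.
  split; [exact: cross_base | exact: Cart_cross | ].
  (* Crossing wall [i] adds the row sum minus 2, times the value of [row i B] at [x0], which is
     positive because the walk leads towards [- x0]. *)
  have -> : \sum_j dotv x0 (row j (cross C i B)) =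
     \sum_j dotv x0 (row j B) + (\sum_(j | j != i) C i j - 2) * dotv x0 (row i B).
    rewrite (bigD1 i) //= [X in _ = X + _](bigD1 i) //= row_cross_id dotvNr.
    rewrite (eq_bigr (fun j => dotv x0 (row j B) + C i j * dotv x0 (row i B))) => [|j hj].
      rewrite big_split /= -mulr_suml; ring.
    by rewrite row_cross_neq // dotvDr dotvZr.
  by rewrite ltr_wpDr // mulr_ge0 ?subr_ge0 // ltW.
move: hs; rewrite ltNge => /negP; apply; apply: sumr_le0 => j _.
by have := hB j; rewrite dotvNl oppr_ge0.
Qed.

End Normalize.

(** * Normal forms for the path and the star, and exclusion of the 4-cycle *)

Section StandardForm.
Variables (R : realType) (s : seq 'rV[R]_4).
Hypotheses (arr : is_arrangement s) (spl : simplicial s) (m6 : mA s = 6%N).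
Hypothesis irr : irreducible s.

Definition graph_mx (g : nat -> nat -> bool) : 'M[R]_4 := \matrix_(i, j) (g i j)%:R.

Section Edges.
Variables (B C : 'M[R]_4) (p : 'I_4 -> 'I_4) (g : nat -> nat -> bool).
Hypotheses (bB : base s B) (hC : Cart s B C) (pI : injective p).
Hypothesis hg : forall i j : 'I_4, i != j -> (C (p i) (p j) != 0) = g i j.

Let c (a b : nat) := C (p (inord a)) (p (inord b)).

Let inord_neq (a b : nat) : (a < 4)%N -> (b < 4)%N -> a != b -> inord a != inord b :> 'I_4.
Proof. by move=> ha hb; apply: contra_neq => /(congr1 val); rewrite /= !inordK. Qed.

Lemma edge_gt0 a b : (a < 4)%N -> (b < 4)%N -> a != b -> g a b -> 0 < c a b.
Proof.
move=> ha hb hab gab; have hn := inord_neq ha hb hab.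
rewrite lt_neqAle eq_sym hg // !inordK // gab /=.
by apply: (cart_ge0 bB hC); rewrite (inj_eq pI).
Qed.

Lemma edge_inv a b : (a < 4)%N -> (b < 4)%N -> a != b -> g a b -> c a b * c b a = 1.
Proof.
move=> ha hb hab gab; have hn := inord_neq ha hb hab.
apply: (edge_prod arr spl m6 irr bB hC); first by rewrite (inj_eq pI).
by rewrite hg // !inordK.
Qed.

(** Only the edges with [a < b] need a condition on [d]; in the reverse direction it follows from
    the product of the two entries being 1. *)
Lemma normalize_tree (d : nat -> R) : symmetric g -> (forall a, 0 < d a) ->
  (forall a b, (a < b)%N -> (b < 4)%N -> g a b -> c a b * d b = d a) ->
  exists2 A, base s A & Cart s A (graph_mx g).
Proof.
move=> gs d0 hd.
have [bA hA] := rescale_base bB hC pI (fun i => d0 (val i)).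
eexists; first exact: bA.
apply: (Cart_ext hA) => i j hij; rewrite !mxE.
case: (boolP (g i j)) => gij; last first.
  by move: gij; rewrite -hg // negbK => /eqP ->; rewrite !mul0r.
suff -> : C (p i) (p j) * d j = d i by rewrite divff ?gt_eqF.
have -> : C (p i) (p j) = c i j by rewrite /c !inord_val.
case: (ltngtP i j) => [h | h | h]; first by apply: hd.
  have gji : g j i by rewrite gs.
  rewrite -(hd _ _ h (ltn_ord i) gji) mulrA mulrC edge_inv ?mulr1 //.
by case/eqP: hij; apply: val_inj.
Qed.

End Edges.

Lemma normalize_path B C p : base s B -> Cart s B C -> injective p ->
  (forall i j : 'I_4, i != j -> (C (p i) (p j) != 0) = pathg i j) ->
  exists2 A, base s A & Cart s A (graph_mx pathg).
Proof.
move=> bB hC pI hg.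
have c0 := edge_gt0 bB hC pI hg.
have c01 := c0 0%N 1%N isT isT isT isT; have c12 := c0 1%N 2%N isT isT isT isT.
have c23 := c0 2%N 3%N isT isT isT isT.
set x := C _ _ in c01; set y := C _ _ in c12; set z := C _ _ in c23.
(* The solution of [c a b * d b = d a] along the path, starting from [d 0 = 1]. *)
pose d a := nth 1 [:: 1; x^-1; (x * y)^-1; (x * y * z)^-1] a.
apply: (normalize_tree bB hC pI hg (d := d)).
- by move=> a b; rewrite /pathg orbC.
- move=> [|[|[|[|a]]]]; rewrite /d //= ?invr_gt0 ?mulr_gt0 ?ltr01 //.
  by rewrite nth_nil ltr01.
have [xn yn zn] : [/\ x != 0, y != 0 & z != 0] by rewrite !gt_eqF.
move=> [|[|[|[|a]]]] [|[|[|[|b]]]] //= _ _ _; rewrite /d /= -?/x -?/y -?/z.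
- by rewrite divff.
- by field; rewrite xn yn.
by field; rewrite xn yn zn.
Qed.

Lemma normalize_star B C p : base s B -> Cart s B C -> injective p ->
  (forall i j : 'I_4, i != j -> (C (p i) (p j) != 0) = starg i j) ->
  exists2 A, base s A & Cart s A (graph_mx starg).
Proof.
move=> bB hC pI hg.
have c0 := edge_gt0 bB hC pI hg.
have c01 := c0 0%N 1%N isT isT isT isT; have c12 := c0 1%N 2%N isT isT isT isT.
have c13 := c0 1%N 3%N isT isT isT isT.
set x := C _ _ in c01; set y := C _ _ in c12; set z := C _ _ in c13.
(* The centre 1 gets weight 1; leaf 0 precedes it, hence [x] and not an inverse. *)
pose d a := nth 1 [:: x; 1; y^-1; z^-1] a.
apply: (normalize_tree bB hC pI hg (d := d)).
- by move=> a b; rewrite /starg orbC.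
- move=> [|[|[|[|a]]]]; rewrite /d //= ?invr_gt0 ?ltr01 //.
  by rewrite nth_nil ltr01.
have [xn yn zn] : [/\ x != 0, y != 0 & z != 0] by rewrite !gt_eqF.
move=> [|[|[|[|a]]]] [|[|[|[|b]]]] //= _ _ _; rewrite /d /= -?/x -?/y -?/z.
- by rewrite mulr1.
- by rewrite divff.
by rewrite divff.
Qed.

(** Rescaling by [d] makes every entry in cyclic direction the fourth root [mu] of their product and
    every opposite one [mu^-1], so each row sum is at least 2. *)
Lemma no_cycle B C p : base s B -> Cart s B C -> injective p ->
  ~ (forall i j : 'I_4, i != j -> (C (p i) (p j) != 0) = cycleg i j).
Proof.
move=> bB hC pI hg.
have c0 := edge_gt0 bB hC pI hg.
have c01 := c0 0%N 1%N isT isT isT isT; have c12 := c0 1%N 2%N isT isT isT isT.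
have c23 := c0 2%N 3%N isT isT isT isT; have c30 := c0 3%N 0%N isT isT isT isT.
set x := C _ _ in c01; set y := C _ _ in c12; set z := C _ _ in c23; set w := C _ _ in c30.
pose mu := Num.sqrt (Num.sqrt (x * y * z * w)).
have mu0 : 0 < mu by rewrite !sqrtr_gt0 !mulr_gt0.
have mu4 : mu ^+ 4 = x * y * z * w.
  by rewrite (exprM mu 2 2) !sqr_sqrtr ?sqrtr_ge0 // !mulr_ge0 // ltW.
pose d a := nth 1 [:: 1; mu / x; mu ^+ 2 / (x * y); mu ^+ 3 / (x * y * z)] a.
have d0 a : 0 < d a.
  move: a => [|[|[|[|a]]]]; rewrite /d //= ?divr_gt0 ?mulr_gt0 ?exprn_gt0 ?ltr01 //.
  by rewrite nth_nil ltr01.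
have [bA hA] := rescale_base bB hC pI (fun i => d0 (val i)).
set A := (\matrix_i _) in bA hA; set C1 := (\matrix_(i, j) _) in hA.
have [xn yn zn] : [/\ x != 0, y != 0 & z != 0] by rewrite !gt_eqF.
have [wn mun] : w != 0 /\ mu != 0 by rewrite !gt_eqF.
pose nx (i : 'I_4) : 'I_4 := inord (i.+1 %% 4).
have vnx (i : 'I_4) : nx i = (i.+1 %% 4)%N :> nat by rewrite inordK // ltn_pmod.
have hnx (i : 'I_4) : C1 i (nx i) = mu.
  rewrite mxE /= vnx -[in C (p i)](inord_val i) /nx.
  case: i => [[|[|[|[|i]]]] hi] //=; rewrite /d /= -/x -/y -/z -/w.
  - by field; rewrite xn.
  - by field; rewrite xn yn mun.
  - by field; rewrite xn yn zn mun.
  have -> : w * 1 / (mu ^+ 3 / (x * y * z)) = x * y * z * w / mu ^+ 3.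
    by field; rewrite xn yn zn mun.
  by rewrite -mu4; field.
have nxn (i : 'I_4) : i != nx i.
  by rewrite -val_eqE /= vnx; case: i => [[|[|[|[|i]]]] hi].
have hpx (i : 'I_4) : C1 (nx i) i = mu^-1.
  have : C1 i (nx i) * C1 (nx i) i = 1.
    by apply: (edge_prod arr spl m6 irr bA hA (nxn i)); rewrite hnx.
  by rewrite hnx => h; apply: (mulfI mun); rewrite h divff.
apply: (no_affine arr spl m6 irr bA hA) => i.
pose pv : 'I_4 := inord ((i + 3) %% 4).
have vpv : pv = ((i + 3) %% 4)%N :> nat by rewrite inordK // ltn_pmod.
have npv : nx pv = i.
  apply/val_inj; rewrite /= vnx vpv.
  by case: i {pv vpv} => [[|[|[|[|i]]]] hi].
have pvi : pv != i by have := nxn pv; rewrite npv.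
have pvn : pv != nx i.
  by rewrite -val_eqE /= vpv vnx; case: i {pv vpv npv pvi} => [[|[|[|[|i]]]] hi].
rewrite (bigD1 (nx i)) /= ?(eq_sym _ i) ?nxn // (bigD1 pv) /=; last by rewrite pvi.
have -> : C1 i pv = mu^-1 by have := hpx pv; rewrite npv.
rewrite hnx addrA.
apply: (@le_trans _ _ (mu + mu^-1)).
  have h : mu + mu^-1 - 2 = (mu - 1) ^+ 2 / mu by field.
  by rewrite -subr_ge0 h divr_ge0 ?sqr_ge0 // ltW.
rewrite lerDl; apply: sumr_ge0 => j /andP [/andP [hj _] _].
by apply: (cart_ge0 bA hA); rewrite eq_sym.
Qed.

Lemma standard_form (x : 'rV[R]_4) : (forall k : 'I_(size s), dotv x s`_k != 0) ->
  exists2 A, base s A & Cart s A (graph_mx pathg) \/ Cart s A (graph_mx starg).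
Proof.
move=> hx; have [B bB _] := chamber_base arr spl hx.
have [C hC] := cart_ex arr spl bB.
have [p pI [g]] := base_graph arr spl m6 irr bB hC.
rewrite !inE => /or3P [] /eqP -> /= hg.
- by have [A bA hA] := normalize_path bB hC pI hg; exists A; auto.
- by have [A bA hA] := normalize_star bB hC pI hg; exists A; auto.
by case: (no_cycle bB hC pI hg).
Qed.

End StandardForm.

(** * The root model *)

(** Hyperplanes are avoided one by one, each by a move too small to meet the earlier ones. *)
Lemma generic_point (R : realType) (s : seq 'rV[R]_4) : is_arrangement s ->
  exists x, forall k : 'I_(size s), dotv x s`_k != 0.
Proof.
move=> arr; have snz k : (k < size s)%N -> s`_k != 0 by case: arr => h _ _; apply: h.
suff h m : (m <= size s)%N -> exists x, forall k, (k < m)%N -> dotv x s`_k != 0.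
  by have [x hx] := h _ (leqnn _); exists x => k; apply: hx.
elim: m => [_ | m IH hm]; first by exists 0.
have [x hx] := IH (ltnW hm).
case: (eqVneq (dotv x s`_m) 0) => [x0 | xn]; last first.
  by exists x => k; rewrite ltnS leq_eqVlt => /orP [/eqP -> // | /hx].
have [u hu] : exists u, dotv u s`_m != 0.
  apply: contrapT => h; case/eqP: (snz m hm); apply: dotv_eq0 => u.
  by apply/eqP; apply: contrapT => /negP hu; apply: h; exists u.
have hf (k : 'I_m) : 0 < dotv x s`_k * dotv x s`_k.
  by rewrite -expr2 exprn_even_gt0 //= hx.
have [e he hep] := small_eps (fun k : 'I_m => dotv x s`_k * dotv u s`_k) hf.
exists (x + e *: u) => k; rewrite dotvDl dotvZl ltnS leq_eqVlt => /orP [/eqP -> | hk].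
  by rewrite x0 add0r mulf_neq0 ?(gt_eqF he).
have := hep (Ordinal hk) => /=.
have -> : dotv x s`_k * dotv x s`_k + e * (dotv x s`_k * dotv u s`_k) =
   dotv x s`_k * (dotv x s`_k + e * dotv u s`_k) by ring.
by move=> h; apply: contraTneq h => ->; rewrite mulr0 ltxx.
Qed.

(* Vectors of [Z^4] are lists, so that the finite verifications below compute. *)
Definition ivec (R : realType) (v : seq int) : 'rV[R]_4 := \row_i (v`_i)%:~R.

Definition irefl (g : nat -> nat -> bool) (i : nat) (v : seq int) : seq int :=
  let t k : int := if (k != i) && g i k then v`_k else 0 in
  [seq (if j == i then - v`_i + (t 0%N + (t 1%N + (t 2%N + t 3%N))) else v`_j) | j <- iota 0 4].

Definition iunits : seq (seq int) :=
  [seq [seq (if j == i then 1 else 0) | j <- iota 0 4] | i <- iota 0 4].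

Definition irefl_closed g (V : seq (seq int)) :=
  all (fun v => all (fun i => (irefl g i v \in V) || (map -%R (irefl g i v) \in V)) (iota 0 4)) V
  && all (fun v => v \in V) iunits.

Definition irefl_step g (L : seq (seq int)) :=
  undup (L ++ flatten [seq [seq irefl g i v | i <- iota 0 4] | v <- L]).

(** Five rounds are enough: in the lists used here no vector is more than four reflections away from
    a unit vector. *)
Definition irefl_reached g (V : seq (seq int)) :=
  all (fun v => v \in iter 5 (irefl_step g) iunits) V.

Definition iindep (v w : seq int) :=
  has (fun a => has (fun b => v`_a * w`_b != v`_b * w`_a) (iota 0 4)) (iota 0 4).

Definition ipairwise (V : seq (seq int)) :=
  all (fun i => all (fun j => (i == j) || iindep (nth [::] V i) (nth [::] V j)) (iota 0 (size V)))
    (iota 0 (size V)).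

Section Model.
Variables (R : realType) (s : seq 'rV[R]_4).
Local Notation ivec := (ivec R).

(** The normals are [V] up to a linear change of coordinates, their order, and nonzero factors. *)
Definition modelled (V : seq (seq int)) :=
  exists A : 'M[R]_4, exists f : 'I_(size s) -> 'I_(size V), exists c : 'I_(size s) -> R,
  [/\ A \in unitmx, bijective f, forall i, c i != 0
    & forall i : 'I_(size s), s`_i = c i *: (ivec (nth [::] V (f i)) *m A)].

Lemma ivec_nth4 (h : nat -> int) (i : 'I_4) : [seq h j | j <- iota 0 4]`_i = h i.
Proof. by case: i => [[|[|[|[|i]]]] hi]. Qed.

Lemma ivec_irefl g (i : 'I_4) v :
  ivec (irefl g i v) = refl (graph_mx R g) i (ivec v).
Proof.
apply/rowP => j; rewrite !mxE /irefl ivec_nth4 val_eqE; case: eqP => // _.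
rewrite rmorphD rmorphN /=; congr (_ + _).
have -> : \sum_(k < 4 | k != i) graph_mx R g i k * ivec v 0 k =
  \sum_(k < 4) (if (k != i :> nat) && g i k then v`_k else 0)%:~R.
  rewrite big_mkcond; apply: eq_bigr => k _; rewrite !mxE val_eqE.
  by case: (k != i) => //=; case: (g i k); rewrite ?mul1r ?mul0r.
by rewrite !big_ord_recl big_ord0 !rmorphD /= addr0.
Qed.

Lemma ivec_opp v : size v = 4%N -> ivec (map -%R v) = - ivec v.
Proof.
move=> sv; apply/rowP => j; rewrite !mxE (nth_map 0) ?sv // rmorphN //.
Qed.

Lemma ivec_units (i : 'I_4) : exists2 v, v \in iunits & ivec v = delta_mx 0 i.
Proof.
exists [seq (if j == i :> nat then 1 else 0) | j <- iota 0 4].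
  by apply/mapP; exists (val i) => //; rewrite mem_iota /=; exact: ltn_ord.
by apply/rowP => j; rewrite !mxE ivec_nth4 eqxx val_eqE; case: eqP.
Qed.

Lemma iindep_scale v w t : iindep v w -> ivec v != t *: ivec w.
Proof.
move=> /hasP [a ha /hasP [b hb]]; apply: contraNneq => e.
rewrite !mem_iota /= in ha hb.
have ea : (v`_a)%:~R = t * (w`_a)%:~R :> R.
  by have /rowP /(_ (Ordinal ha)) := e; rewrite !mxE.
have eb : (v`_b)%:~R = t * (w`_b)%:~R :> R.
  by have /rowP /(_ (Ordinal hb)) := e; rewrite !mxE.
apply/eqP/(@intr_inj R); rewrite !rmorphM /= ea eb; ring.
Qed.

Hypotheses (arr : is_arrangement s) (spl : simplicial s) (m6 : mA s = 6%N).
Hypothesis irr : irreducible s.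
Variables (g : nat -> nat -> bool) (V : seq (seq int)) (A : 'M[R]_4).
Hypotheses (Vc : irefl_closed g V) (Vr : irefl_reached g V) (Vi : ipairwise V).
Hypotheses (bA : base s A) (hA : Cart s A (graph_mx R g)).

(** Proved for all bases with this Cartan matrix at once: the coefficients [irefl g i u] over [B]
    describe the vector with coefficients [u] over the neighbouring base, where induction
    applies. *)
Lemma model_isroot v : v \in V -> isroot s (ivec v *m A).
Proof.
move=> vV; move/allP: Vr => /(_ v vV).
pose good (L : seq (seq int)) := forall w, w \in L ->
  forall B, base s B -> Cart s B (graph_mx R g) -> isroot s (ivec w *m B).
suff : good (iter 5 (irefl_step g) iunits) by move=> h /h; apply.
elim: 5%N => [|n IH] /=.
  move=> w /mapP [i]; rewrite mem_iota /= => hi -> B [_ rB _] _.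
  have -> : ivec [seq (if j == i :> nat then 1 else 0) | j <- iota 0 4] = delta_mx 0 (Ordinal hi).
    by apply/rowP => j; rewrite !mxE ivec_nth4 eqxx -val_eqE /=; case: eqP.
  by rewrite -rowE.
move=> w; rewrite mem_undup mem_cat => /orP [/IH // | /flatten_mapP [u uL]].
move=> /mapP [i]; rewrite mem_iota /= => hi -> B bB hB.
rewrite (ivec_irefl g (Ordinal hi)) -mul_cross; apply: IH => //.
  exact: cross_base.
exact: Cart_cross.
Qed.

(** On a walk from [A] to the opposite chamber the root must change sign. This happens only where it
    is a multiple of the base vector being crossed, and by closedness of [V] every base vector met
    is, up to sign, a vector of [V] over [A]. *)
Lemma root_model (k : 'I_(size s)) :
  exists2 v, v \in V & exists2 t, t != 0 & s`_k = t *: (ivec v *m A).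
Proof.
apply: contrapT => hn; have [uA rA hAA] := bA.
have rk : isroot s s`_k by exists k, 1; rewrite ?oner_eq0 ?scale1r.
have [u eu] := root_coords s`_k uA.
have [e he u0] : exists2 e : R, e != 0 & forall i, 0 <= e * u 0 i.
  move: (rk); rewrite eu => /hAA [h | h]; first by exists 1; rewrite ?oner_eq0 // => i; rewrite mul1r.
  exists (-1) => [|i]; first by rewrite oppr_eq0 oner_eq0.
  by rewrite mulN1r oppr_ge0.
have /andP [/allP Vc1 /allP Vc2] := Vc.
pose Inv B := [/\ base s B, Cart s B (graph_mx R g),
  forall v, v \in V -> exists2 w, w \in V & ivec v *m B = ivec w *m A \/ ivec v *m B = - (ivec w *m A)
  & exists2 w, e *: s`_k = w *m B & forall i, 0 <= w 0 i].
have IA : Inv A.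
  split=> //; first by move=> v vV; exists v; auto.
  by exists (e *: u) => [|i]; rewrite ?eu ?scalemxAl // mxE.
have rowInv B i : Inv B -> exists2 w, w \in V & exists2 t, t != 0 & row i B = t *: (ivec w *m A).
  move=> [_ _ h _]; have [v vu ev] := ivec_units i.
  have [w wV hw] := h v (Vc2 _ vu); exists w => //.
  rewrite rowE -ev; case: hw => ->.
    by exists 1; rewrite ?oner_eq0 ?scale1r.
  by exists (-1); rewrite ?oppr_eq0 ?oner_eq0 ?scaleN1r.
have [||B IB hB] := walk arr spl IA (y := - inner A); first by move=> B [].
  move=> B C i IB hC hi; have [bB hBg hV [w ew w0]] := IB.
  rewrite (@cross_ext R B C (graph_mx R g) i) => [|j hij]; last exact: Cart_uniq hC hBg hij.
  have bE : base s (cross (graph_mx R g) i B) by apply: cross_base.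
  split=> //; first exact: Cart_cross.
    move=> v vV; rewrite mul_cross -ivec_irefl.
    have i4 : val i \in iota 0 4 by rewrite mem_iota /=; exact: ltn_ord.
    have := allP (Vc1 v vV) _ i4 => /orP [] /hV [w' w'V hw']; exists w' => //.
    move: hw'; rewrite ivec_opp ?size_map ?size_iota // mulNmx.
    by case=> h; [right | left]; rewrite -[LHS]opprK h ?opprK.
  have [uB _ hBB] := bB; have [_ _ hEE] := bE.
  exists (refl (graph_mx R g) i w); first by rewrite refl_mul_cross.
  have rw : isroot s (refl (graph_mx R g) i w *m cross (graph_mx R g) i B).
    by rewrite refl_mul_cross -ew; apply: isrootZ.
  case: (hEE _ rw) => // h.
  have [j hj wj] : exists2 j, j != i & w 0 j != 0.
    apply: contrapT => hw; apply: hn.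
    have [v vV [t ht et]] := rowInv B i IB.
    exists v => //.
    have ewi : e *: s`_k = w 0 i *: row i B.
      rewrite ew mulmx_sum_row (bigD1 i) //= big1 ?addr0 // => j hj.
      suff -> : w 0 j = 0 by rewrite scale0r.
      by apply/eqP; apply: contrapT => /negP h1; apply: hw; exists j.
    exists (e^-1 * w 0 i * t); last first.
      by rewrite -scalerA -et -scalerA -ewi scalerA mulVf // scale1r.
    rewrite !mulf_neq0 ?invr_eq0 //; apply: contraTneq isT => wi0.
    have := isroot_nz arr rk; have /eqP := ewi; rewrite wi0 scale0r scaler_eq0 (negPf he) /=.
    by move=> /eqP ->; rewrite eqxx.
  have := h j; rewrite mxE (negPf hj) => h1.
  by case/eqP: wj; apply/eqP; rewrite eq_le h1 w0.
have [[uB _ _] _ _ [w ew w0]] := IB.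
have h1 : 0 <= dotv (- inner A) (e *: s`_k).
  rewrite ew dotv_mulmx; apply: sumr_ge0 => i _; exact: mulr_ge0.
have h2 : 0 < dotv (inner A) (e *: s`_k).
  rewrite eu dotvZr inner_comb // mulr_sumr lt_neqAle sumr_ge0 // andbT eq_sym.
  apply/eqP => h; case/eqP: (isroot_nz arr rk); rewrite eu.
  suff -> : u = 0 by rewrite mul0mx.
  apply/rowP => i; rewrite mxE; apply/eqP.
  have h3 : forall j, xpredT j -> e * u 0 j = 0.
    by apply: psumr_eq0P => // j _; apply: u0.
  by have /eqP := h3 i isT; rewrite mulf_eq0 (negPf he).
by move: h1; rewrite dotvNl oppr_ge0 leNgt h2.
Qed.

Lemma model_of_base : modelled V.
Proof.
have [uA _ _] := bA.
have /fin_all_exists [f /fin_all_exists [c h]] : forall k : 'I_(size s),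
   exists i : 'I_(size V), exists c : R, c != 0 /\ s`_k = c *: (ivec (nth [::] V i) *m A).
  move=> k; have [v vV [t ht et]] := root_model k.
  have hi : (index v V < size V)%N by rewrite index_mem.
  by exists (Ordinal hi), t; rewrite /= nth_index.
have Vn (a b : 'I_(size V)) t : a != b -> ivec (nth [::] V a) != t *: ivec (nth [::] V b).
  move=> hab; apply: iindep_scale.
  have ia (x : 'I_(size V)) : val x \in iota 0 (size V) by rewrite mem_iota /=.
  have /allP /(_ _ (ia b)) := allP Vi _ (ia a).
  by rewrite val_eqE (negPf hab).
exists A, f, c; split=> //; try by move=> i; have [] := h i.
have fI : injective f.
  move=> i j e; have [ci ei] := h i; have [cj ej] := h j.
  apply: (hyp_inj arr (t := c i / c j)); first by rewrite mulf_neq0 ?invr_eq0.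
  by rewrite ej -e ei scalerA divfK.
have fS a : exists i, f i = a.
  have [k [t ht et]] := model_isroot (mem_nth [::] (ltn_ord a)).
  exists k; apply/eqP; rewrite eq_sym; apply: contraT => hn.
  have [ck ek] := h k; move: et; rewrite ek scalerA scalemxAl => /(row_comb_inj uA) e.
  by case/eqP: (Vn _ _ (t * c k) hn).
have [f' hf'] := fin_all_exists fS.
by exists f' => // i; apply: fI; rewrite hf'.
Qed.

End Model.

(** * Integer linear algebra and the lattice of flats *)

Definition idot (v w : seq int) : int :=
  v`_0 * w`_0 + (v`_1 * w`_1 + (v`_2 * w`_2 + v`_3 * w`_3)).

Definition icomb (a : int) (v : seq int) (b : int) (w : seq int) : seq int :=
  [seq a * v`_j + b * w`_j | j <- iota 0 4].

(* One elimination step: from a basis of a subspace to a basis of its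
   intersection with the hyperplane orthogonal to [v]. *)
Definition kstep (b : seq (seq int)) (v : seq int) : seq (seq int) :=
  let p := find (fun r => idot r v != 0) b in
  if (p < size b)%N then
    let r0 := nth [::] b p in
    [seq icomb (idot r0 v) r (- idot r v) r0 | r <- take p b ++ drop p.+1 b]
  else b.

Definition ikernel (vs : seq (seq int)) := foldl kstep iunits vs.

Section Kernel.
Variable R : realType.
Local Notation ivec := (ivec R).
Implicit Types (x y : 'rV[R]_4) (b vs : seq (seq int)) (v w r : seq int).

Definition ispan b : 'M[R]_4 := (\sum_(r <- b) <<ivec r>>)%MS.

Lemma dotv_ivec v w : dotv (ivec v) (ivec w) = (idot v w)%:~R.
Proof.
rewrite /dotv mxE !big_ord_recl big_ord0 !mxE /= /idot.
by rewrite !rmorphD !rmorphM /= addr0.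
Qed.

Lemma ivec_icomb a v c w : ivec (icomb a v c w) = a%:~R *: ivec v + c%:~R *: ivec w.
Proof. by apply/rowP => j; rewrite !mxE ivec_nth4 rmorphD !rmorphM. Qed.

Lemma ispan_perm b b' : perm_eq b b' -> ispan b = ispan b'.
Proof. by move=> h; rewrite /ispan (perm_big _ h). Qed.

Lemma mem_ispan r b : r \in b -> (ivec r <= ispan b)%MS.
Proof.
elim: b => // r' b IH; rewrite inE /ispan big_cons => /orP [/eqP -> | /IH h].
  by apply: submx_trans (addsmxSl _ _); rewrite genmxE.
exact: submx_trans h (addsmxSr _ _).
Qed.

Lemma ispan_consP r b x : (x <= ispan (r :: b))%MS ->
  exists t, exists2 y, (y <= ispan b)%MS & x = t *: ivec r + y.
Proof.
rewrite /ispan big_cons => /sub_addsmxP [[u1 u2] /= e].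
have /submxP [t et] : (u1 *m <<ivec r>> <= ivec r)%MS.
  by apply: submx_trans (submxMl _ _) _; rewrite genmxE.
exists (t 0 0), (u2 *m ispan b); first exact: submxMl.
by rewrite e et [t]mx11_scalar mul_scalar_mx mxE eqxx.
Qed.

Lemma ispan_sub b (M : 'M[R]_4) : (forall r, r \in b -> (ivec r <= M)%MS) -> (ispan b <= M)%MS.
Proof.
elim: b => [|r b IH] h; first by rewrite /ispan big_nil sub0mx.
rewrite /ispan big_cons addsmx_sub genmxE h ?inE ?eqxx //=; apply: IH => r' hr'.
by apply: h; rewrite inE hr' orbT.
Qed.

Lemma rank_ispan b : (\rank (ispan b) <= size b)%N.
Proof.
elim: b => [|r b IH]; first by rewrite /ispan big_nil mxrank0.
rewrite /ispan big_cons; apply: leq_trans (mxrank_adds_leqif _ _) _ => /=.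
rewrite -[(size b).+1]add1n leq_add // genmxE; exact: rank_leq_row.
Qed.

Definition orth w : 'M[R]_4 := kermx (ivec w)^T.

Lemma mem_orth x w : (x <= orth w)%MS = (dotv x (ivec w) == 0).
Proof. by have := mem_hyp [:: ivec w] x 0. Qed.

Lemma rank_orth w : (3 <= \rank (orth w))%N.
Proof. by rewrite mxrank_ker mxrank_tr; have := rank_leq_row (ivec w); lia. Qed.

(** Scaling by [idot r0 v] keeps the elimination in the integers. Conversely, a suitable multiple of
    a vector orthogonal to [v] is a combination of the corrected vectors plus a multiple of the
    pivot [r0], and orthogonality kills that last multiple. *)
Lemma ispan_elim r0 b v (b' := [seq icomb (idot r0 v) r (- idot r v) r0 | r <- b]) :
  idot r0 v != 0 -> (ispan b' :=: ispan (r0 :: b) :&: orth v)%MS.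
Proof.
move=> p0; have p0R : (idot r0 v)%:~R != 0 :> R by rewrite intr_eq0.
apply/eqmxP/andP; split.
  apply: ispan_sub => _ /mapP [r rb ->]; rewrite sub_capmx mem_orth ivec_icomb; apply/andP; split.
    by rewrite addmx_sub // scalemx_sub // mem_ispan // inE ?eqxx ?rb ?orbT.
  rewrite dotvDl !dotvZl !dotv_ivec -!rmorphM -rmorphD /=.
  by rewrite (_ : _ + _ = 0) //; ring.
have lift y : (y <= ispan b)%MS ->
    exists t, (((idot r0 v)%:~R *: y + t *: ivec r0)%R <= ispan b')%MS.
  rewrite /b'; elim: b y {b'} => [|r b IH] y.
    rewrite /ispan big_nil submx0 => /eqP ->; exists 0.
    by rewrite scaler0 add0r scale0r sub0mx.
  move=> /ispan_consP [t [z /IH [t' ht'] ->]].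
  exists (t' - t * (idot r v)%:~R).
  have -> : (idot r0 v)%:~R *: (t *: ivec r + z) + (t' - t * (idot r v)%:~R) *: ivec r0 =
    t *: ivec (icomb (idot r0 v) r (- idot r v) r0) + ((idot r0 v)%:~R *: z + t' *: ivec r0).
    rewrite ivec_icomb; apply/rowP => j; rewrite !mxE; ring.
  rewrite /ispan big_cons addmx_sub_adds //.
  by rewrite genmxE scalemx_sub.
apply/row_subP => i; set x := row i _.
have : (x <= ispan (r0 :: b) :&: orth v)%MS by apply: row_sub.
rewrite sub_capmx mem_orth => /andP [/ispan_consP [t [y /lift [t' hy] ex]] /eqP xv].
have yv : dotv ((idot r0 v)%:~R *: y + t' *: ivec r0) (ivec v) = 0.
  apply/eqP; rewrite -mem_orth; apply: submx_trans hy _.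
  apply: ispan_sub => _ /mapP [r rb ->]; rewrite mem_orth ivec_icomb.
  rewrite dotvDl !dotvZl !dotv_ivec -!rmorphM -rmorphD /=.
  by rewrite (_ : _ + _ = 0) //; ring.
have et : t' = (idot r0 v)%:~R * t.
  move: xv yv; rewrite ex !dotvDl !dotvZl !dotv_ivec => h1 h2.
  apply: (mulIf p0R); apply/eqP; rewrite -subr_eq0; apply/eqP.
  rewrite (_ : _ - _ = ((idot r0 v)%:~R * dotv y (ivec v) + t' * (idot r0 v)%:~R)
     - (idot r0 v)%:~R * (t * (idot r0 v)%:~R + dotv y (ivec v))); last by ring.
  by rewrite h1 h2 mulr0 subrr.
have -> : x = (idot r0 v)%:~R^-1 *: ((idot r0 v)%:~R *: y + t' *: ivec r0).
  rewrite ex et; apply/rowP => j; rewrite !mxE; field; exact: p0R.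
exact: scalemx_sub.
Qed.

(** A hyperplane lowers the dimension by at most one, while an elimination step drops exactly one
    vector; so the list stays independent. *)
Lemma ispan_kstep b v : \rank (ispan b) = size b ->
  (ispan (kstep b v) :=: ispan b :&: orth v)%MS /\ \rank (ispan (kstep b v)) = size (kstep b v).
Proof.
move=> rb; rewrite /kstep -has_find; case: (boolP (has _ _)) => hb; last first.
  split=> //; apply/eqmxP/andP; split; last exact: capmxSl.
  rewrite sub_capmx submx_refl /=; apply: ispan_sub => r hr; rewrite mem_orth dotv_ivec.
  by move/hasPn: hb => /(_ r hr); rewrite negbK => /eqP ->.
set p := find _ b; set r0 := nth _ b p.
have p0 : idot r0 v != 0 by apply: (nth_find [::] hb).
have hp : (p < size b)%N by rewrite -has_find.
have pb : perm_eq b (r0 :: (take p b ++ drop p.+1 b)).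
  rewrite -{1}(cat_take_drop p b) (drop_nth [::]) // perm_catC /= perm_cons perm_catC //.
have e := ispan_elim (take p b ++ drop p.+1 b) p0; rewrite -(ispan_perm pb) in e.
split=> //; apply/eqP; rewrite eqn_leq rank_ispan e.
have := mxrank_sum_cap (ispan b) (orth v); have := rank_orth v.
have := rank_leq_col (ispan b + orth v)%MS.
have := perm_size pb; rewrite rb size_map /= => ->.
lia.
Qed.

Lemma ispan_units : (ispan iunits :=: 1%:M)%MS /\ \rank (ispan iunits) = 4%N.
Proof.
have e : (ispan iunits :=: 1%:M)%MS.
  apply/eqmxP; rewrite submx1 /=; apply/row_subP => i; rewrite rowE mulmx1.
  by have [v vu <-] := @ivec_units R i; apply: mem_ispan.
by split=> //; rewrite e mxrank1.
Qed.

Lemma ispan_kernel vs :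
  \rank (ispan (ikernel vs)) = size (ikernel vs) /\
  forall x, (x <= ispan (ikernel vs))%MS <-> forall v, v \in vs -> dotv x (ivec v) = 0.
Proof.
rewrite /ikernel; elim/last_ind: vs => [|vs v [rk IH]].
  have [e r4] := ispan_units; split=> //= x; split=> // _.
  by rewrite e submx1.
rewrite foldl_rcons; have [e r'] := ispan_kstep v rk; split=> // x.
rewrite e sub_capmx mem_orth; split=> [/andP [/IH h /eqP hv] w | h].
  by rewrite mem_rcons inE => /orP [/eqP -> // | /h].
apply/andP; split; last by apply/eqP/h; rewrite mem_rcons inE eqxx.
by apply/IH => w hw; apply: h; rewrite mem_rcons inE hw orbT.
Qed.

End Kernel.

(** * The lattice of closed subsets of a list of integer vectors, as bit strings *)

Section Lattice.
Variable V : seq (seq int).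

(** The dimension of the flat cut out, not the rank of the chosen vectors: the empty set has value
    4. *)
Definition mrank (K : bitseq) : nat := size (ikernel (mask K V)).
Definition mclosure (K : bitseq) : bitseq :=
  let b := ikernel (mask K V) in [seq all (fun r => idot r v == 0) b | v <- V].
Definition msub (K K' : bitseq) : bool := all (fun p => p.1 ==> p.2) (zip K K').

Definition mflats_step (L : seq bitseq) : seq bitseq :=
  undup (L ++ [seq mclosure (set_nth false K k true) | K <- L, k <- iota 0 (size V)]).
Definition mflats : seq bitseq := iter 4 mflats_step [:: mclosure (nseq (size V) false)].

(** A certificate that [L] lists all flats once: distinct closed sets, including the closure of the
    empty set, and stable under adding one vector and closing. *)
Definition mflats_spec (L : seq bitseq) : bool :=
  [&& uniq L, mclosure (nseq (size V) false) \in L,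
     all (fun K => (size K == size V) && (mclosure K == K)) L
   & all (fun K => all (fun k => mclosure (set_nth false K k true) \in L) (iota 0 (size V))) L].

(* The Moebius function of the lattice [L] of closed sets; [k] is the fuel. *)
Fixpoint mmu (L : seq bitseq) (k : nat) (K : bitseq) : int :=
  if mrank K == 4%N then 1 else
  if k is k'.+1 then
    - foldr +%R 0 [seq mmu L k' K' | K' <- L & msub K' K && ~~ msub K K']
  else 0.

End Lattice.

Lemma mem_maskP (V : seq (seq int)) (K : bitseq) (v : seq int) :
  (v \in mask K V) <-> exists2 k, (k < size V)%N && nth false K k & nth [::] V k = v.
Proof.
elim: V K => [|w V IH] [|b K] /=; try by split=> // -[k]; rewrite ?nth_nil ?andbF ?ltn0.
split.
  case: b => /=; rewrite ?inE => h; last by have [k hk <-] := (IH K).1 h; exists k.+1.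
  case/orP: h => [/eqP -> | h]; first by exists 0%N.
  by have [k hk <-] := (IH K).1 h; exists k.+1.
case=> [[|k]] /= hk e; first by move: hk; case: b => // _; rewrite e inE eqxx.
have h : v \in mask K V by apply/IH; exists k.
by case: b; rewrite ?inE h ?orbT.
Qed.

Lemma msubP (K K' : bitseq) : size K = size K' ->
  reflect (forall k, (k < size K)%N -> nth false K k -> nth false K' k) (msub K K').
Proof.
move=> sK; apply: (iffP (all_nthP (false, false))) => h k hk.
  have := h k; rewrite size_zip -sK minnn => /(_ hk).
  by rewrite nth_zip //= => /implyP.
rewrite size_zip -sK minnn in hk; rewrite nth_zip //=; apply/implyP; exact: h.
Qed.

Lemma genmx_eqP (R : realType) (M N : 'M[R]_4) :
  (forall x : 'rV[R]_4, (x <= M)%MS <-> (x <= N)%MS) -> <<M>>%MS = <<N>>%MS.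
Proof.
move=> h; apply/genmxP/andP.
by split; apply/rV_subP => x; move: (h x) => [h1 h2].
Qed.

(** * Transfer of flats, weights and the Moebius function from the model *)

Section ModelFlats.
Variables (R : realType) (s : seq 'rV[R]_4) (V : seq (seq int)).
Variables (A : 'M[R]_4) (f : 'I_(size s) -> 'I_(size V)) (c : 'I_(size s) -> R).
Hypotheses (uA : A \in unitmx) (fb : bijective f) (c0 : forall i, c i != 0).
Hypothesis es : forall i : 'I_(size s), s`_i = c i *: (ivec R (nth [::] V (f i)) *m A).
Variable L : seq bitseq.
Hypothesis hL : mflats_spec V L.
Implicit Types (x : 'rV[R]_4) (K : bitseq).

Let L_uniq : uniq L. Proof. by case/and4P: hL. Qed.
Let L_size K : K \in L -> size K = size V.
Proof. by case/and4P: hL => _ _ /allP h _ /h /andP [/eqP]. Qed.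
Let L_closed K : K \in L -> mclosure V K = K.
Proof. by case/and4P: hL => _ _ /allP h _ /h /andP [_ /eqP]. Qed.

Definition coord x : 'rV[R]_4 := x *m A^T.

Lemma dotv_model x (i : 'I_(size s)) : (dotv x s`_i == 0) = (dotv (coord x) (ivec R (nth [::] V (f i))) == 0).
Proof.
rewrite es dotvZr mulf_eq0 (negPf (c0 i)) /=.
by rewrite /dotv trmx_mul mulmxA.
Qed.

(** Put in the same canonical form as [flat], so that equal subspaces are equal matrices. *)
Definition mflat K : 'M[R]_4 := <<ispan R (ikernel (mask K V)) *m invmx A^T>>%MS.

Let uAT : A^T \in unitmx. Proof. by rewrite unitmx_tr. Qed.

Lemma mflat_coord x K : (x <= mflat K)%MS = (coord x <= ispan R (ikernel (mask K V)))%MS.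
Proof.
rewrite genmxE -[x in LHS](mulmxK uAT) submxMfree //.
by rewrite row_free_unit unitmx_inv.
Qed.

Lemma mem_mflat x K : (x <= mflat K)%MS <-> forall k, (k < size V)%N -> nth false K k ->
  dotv (coord x) (ivec R (nth [::] V k)) = 0.
Proof.
rewrite mflat_coord; have [_ ->] := @ispan_kernel R (mask K V); split=> h.
  by move=> k hk Kk; apply: h; apply/mem_maskP; exists k; rewrite ?hk.
by move=> v /mem_maskP [k /andP [hk Kk] <-]; apply: h.
Qed.

Lemma rank_mflat K : \rank (mflat K) = mrank V K.
Proof.
rewrite genmxE mxrankMfree ?row_free_unit ?unitmx_inv //.
by have [] := @ispan_kernel R (mask K V).
Qed.

Lemma nth_mclosure K k : (k < size V)%N -> nth false (mclosure V K) k <->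
  forall x, (x <= mflat K)%MS -> dotv (coord x) (ivec R (nth [::] V k)) = 0.
Proof.
move=> hk; rewrite /mclosure (nth_map [::]) //; split=> [/allP h x | h].
  rewrite mflat_coord => hx; apply/eqP; rewrite -mem_orth; apply: submx_trans hx _.
  by apply: ispan_sub => r /h /eqP e; rewrite mem_orth dotv_ivec e.
apply/allP => r hr; have := h (ivec R r *m invmx A^T).
rewrite mflat_coord /coord mulmxKV // => /(_ (mem_ispan R hr)) /eqP.
by rewrite dotv_ivec intr_eq0.
Qed.

Lemma mclosure_eq K K' : mflat K = mflat K' -> mclosure V K = mclosure V K'.
Proof.
move=> e; apply: (@eq_from_nth _ false); first by rewrite !size_map.
move=> k; rewrite size_map => hk; apply/idP/idP => /(nth_mclosure _ hk) h;
  by apply/(nth_mclosure _ hk); move: h; rewrite e.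
Qed.

Lemma sub_mclosure K k : (k < size V)%N -> nth false K k -> nth false (mclosure V K) k.
Proof. by move=> hk Kk; apply/(nth_mclosure K hk) => x /mem_mflat; apply. Qed.

Lemma mflat_sub K K' : (mflat K <= mflat K')%MS <->
  forall k, (k < size V)%N -> nth false K' k -> nth false (mclosure V K) k.
Proof.
split=> [h k hk Kk | h].
  apply/(nth_mclosure K hk) => x hx.
  by have /mem_mflat := submx_trans hx h; apply.
apply/rV_subP => x hx; apply/mem_mflat => k hk Kk.
by have /(nth_mclosure K hk) := h k hk Kk; apply.
Qed.

Lemma mflat_ext (M : 'M[R]_4) K : (forall x, (x <= M)%MS <-> (x <= mflat K)%MS) ->
  <<M>>%MS = mflat K.
Proof.
move=> h; rewrite /mflat -[RHS]genmx_id; exact: genmx_eqP.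
Qed.

Lemma flatK (J : {set 'I_(size s)}) : <<flat J>>%MS = flat J.
Proof. by rewrite /flat genmx_id. Qed.

Lemma mflat_mclosure K : mflat (mclosure V K) = mflat K.
Proof.
suff <- : <<mflat (mclosure V K)>>%MS = mflat K by rewrite /mflat genmx_id.
apply: mflat_ext => x; split; last first.
  by move=> h; apply: submx_trans h _; apply/mflat_sub.
move=> /mem_mflat h; apply/mem_mflat => k hk Kk; apply: h => //.
exact: sub_mclosure.
Qed.

Lemma flat_mflat (J : {set 'I_(size s)}) K :
  (forall m, m \in J = nth false K (f m)) -> flat J = mflat K.
Proof.
move=> h; rewrite -flatK; apply: mflat_ext => x; rewrite mem_flat mem_mflat.
have [f' fK f'K] := fb; split=> hx.
  move=> k hk Kk; have e : nat_of_ord (f (f' (Ordinal hk))) = k by rewrite f'K.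
  by apply/eqP; rewrite -[in nth _ _ k]e -dotv_model hx // h e.
by move=> m; rewrite h => Km; apply/eqP; rewrite dotv_model hx.
Qed.

Lemma mflat_setbit (J : {set 'I_(size s)}) m K : flat J = mflat K ->
  flat (m |: J) = mflat (set_nth false K (f m) true).
Proof.
move=> h; rewrite -flatK; apply: mflat_ext => x; rewrite mem_flat mem_mflat.
have hx0 : (x <= flat J)%MS <-> (x <= mflat K)%MS by rewrite h.
rewrite mem_flat mem_mflat in hx0; split=> hx.
  move=> k hk; rewrite nth_set_nth /=; case: eqP => [-> _ | _ Kk].
    by apply/eqP; rewrite -dotv_model hx // inE set11.
  by apply: hx0.1 => // m' hm'; apply: hx; rewrite inE hm' orbT.
move=> m'; rewrite !inE => /orP [/eqP -> | hm'].
  by apply/eqP; rewrite dotv_model hx // nth_set_nth /= eqxx.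
apply: hx0.2 => // k hk Kk; apply: hx => //.
by rewrite nth_set_nth /=; case: eqP.
Qed.

Lemma flat_in_model (J : {set 'I_(size s)}) : exists2 K, K \in L & flat J = mflat K.
Proof.
have -> : J = [set m in enum J] by apply/setP => m; rewrite inE mem_enum.
case/and4P: hL => _ h0 _ /allP hs.
elim: (enum J) => [|m l [K KL IH]].
  exists (mclosure V (nseq (size V) false)) => //.
  rewrite mflat_mclosure; apply: flat_mflat => m.
  by rewrite inE in_nil nth_nseq if_same.
exists (mclosure V (set_nth false K (f m) true)).
  by apply: (allP (hs K KL)); rewrite mem_iota /=.
rewrite mflat_mclosure -(mflat_setbit m IH); congr flat.
by apply/setP => m'; rewrite !inE.
Qed.

Lemma mflat_le K K' : K \in L -> K' \in L -> (mflat K <= mflat K')%MS = msub K' K.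
Proof.
move=> KL KL'; apply/idP/msubP; rewrite ?L_size //.
  by move=> /mflat_sub h k hk; rewrite -(L_closed KL); apply: h.
by move=> h; apply/mflat_sub => k hk; rewrite (L_closed KL); apply: h.
Qed.

Lemma mflat_inj : {in L &, injective mflat}.
Proof.
move=> K K' KL KL' e.
have h1 : msub K' K by rewrite -mflat_le // e.
have h2 : msub K K' by rewrite -mflat_le // e.
have [sK sK'] := (L_size KL, L_size KL').
apply: (@eq_from_nth _ false); first by rewrite sK sK'.
move=> k hk; apply/idP/idP.
  by apply: (msubP _ h2) => //; rewrite sK sK'.
by apply: (msubP _ h1); rewrite ?sK ?sK' // -sK.
Qed.

Lemma flats_model : perm_eq (flats s) [seq mflat K | K <- L].
Proof.
apply: uniq_perm; first exact: undup_uniq.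
  by rewrite map_inj_in_uniq //; exact: mflat_inj.
move=> X; rewrite mem_undup; apply/mapP/mapP => [[J _ ->] | [K KL ->]].
  by have [K KL e] := flat_in_model J; exists K.
exists [set m | nth false K (f m)]; first by rewrite mem_enum.
by apply/esym/flat_mflat => m; rewrite inE.
Qed.

(** Since [K] is closed, its bits mark exactly the hyperplanes through the flat. *)
Lemma weight_mflat K : K \in L -> weight s (mflat K) = count id K.
Proof.
move=> KL; rewrite /weight; have [f' fK f'K] := fb.
have -> : [set i : 'I_(size s) | (mflat K <= hyp s i)%MS] = f @^-1: [set k : 'I_(size V) | nth false K k].
  apply/setP => i; rewrite !inE; apply/rV_subP/idP => [h | Ki x hx].
    rewrite -(L_closed KL); apply/nth_mclosure => // x /h.
    by rewrite mem_hyp dotv_model => /eqP.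
  rewrite mem_hyp dotv_model; apply/eqP.
  by move: hx => /mem_mflat; apply.
rewrite on_card_preimset; last exact: onW_bij.
rewrite cardsE cardE size_filter -enumT.
rewrite -[in RHS](mkseq_nth false K) (L_size KL) /mkseq -val_enum_ord -map_comp count_map.
exact: eq_count.
Qed.

Lemma hnum_model k : hnum s k = count (fun K => (mrank V K == 2%N) && (count id K == k)) L.
Proof.
rewrite /hnum (permP flats_model) count_map; apply: eq_in_count => K KL /=.
by rewrite rank_mflat weight_mflat.
Qed.

Lemma muF_model k K : K \in L -> muF s k (mflat K) = mmu V L k K.
Proof.
elim: k K => [|k IH] K KL /=; rewrite /row_full rank_mflat //.
case: ifP => // _; congr (- _).
rewrite (perm_big _ flats_model) big_map /=.
have -> : foldr +%R 0 [seq mmu V L k K' | K' <- L & msub K' K && ~~ msub K K'] =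
  \sum_(K' <- L | msub K' K && ~~ msub K K') mmu V L k K'.
  by rewrite -big_filter unlock /reducebig foldr_map.
rewrite big_seq_cond [RHS]big_seq_cond; apply: eq_big => [K' | K' /andP [KL' _]]; last exact: IH.
case: (boolP (K' \in L)) => // KL' /=.
by rewrite /ltmx !mflat_le.
Qed.

Lemma charpoly_model :
  charpoly s = \sum_(K <- L) (mmu V L 4 K)%:~R *: 'X^(mrank V K).
Proof.
rewrite /charpoly (perm_big _ flats_model) big_map; apply: eq_big_seq => K KL.
by rewrite muF_model // rank_mflat.
Qed.

Lemma size_model : size s = size V.
Proof.
have [f' fK f'K] := fb; rewrite -[LHS]card_ord -[RHS]card_ord.
exact: bij_eq_card fb.
Qed.

End ModelFlats.

(** * The arrangements A_4 and D_4 *)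

Section CellIso.
Variable R : realType.

Lemma sgz_sqr (x : R) : x != 0 -> sgz x * sgz x = 1.
Proof. by case: sgzP. Qed.

(** Points with the same model coordinates correspond; corresponding normals then differ only by
    factors, whose signs make up [w]. *)
Lemma modelled_sign (s t : seq 'rV[R]_4) (V : seq (seq int)) :
  modelled s V -> modelled t V ->
  exists g : 'I_(size t) -> 'I_(size s), exists w : 'I_(size t) -> int,
  [/\ bijective g, forall k, w k * w k = 1,
      forall x : 'rV[R]_4, exists y, forall k : 'I_(size t),
        sgz (dotv y t`_k) = w k * sgz (dotv x s`_(g k))
    & forall y : 'rV[R]_4, exists x, forall k : 'I_(size t),
        sgz (dotv y t`_k) = w k * sgz (dotv x s`_(g k))].
Proof.
move=> [A [f [c [uA [f' fK f'K] c0 es]]]] [B [h [e [uB [h' hK h'K] e0 et]]]].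
exists (f' \o h), (fun k => sgz (e k) * sgz (c (f' (h k)))).
have key x y : x *m A^T = y *m B^T -> forall k : 'I_(size t),
   sgz (dotv y t`_k) = sgz (e k) * sgz (c (f' (h k))) * sgz (dotv x s`_(f' (h k))).
  move=> exy k; rewrite es et f'K !dotvZr !sgzM.
  have -> : dotv y (ivec R (nth [::] V (h k)) *m B) = dotv x (ivec R (nth [::] V (h k)) *m A).
    by rewrite /dotv !trmx_mul !mulmxA exy.
  by rewrite mulrA -[_ * _ * sgz (c _)]mulrA sgz_sqr // mulr1.
split.
- by exists (h' \o f) => k /=; rewrite ?f'K ?hK ?h'K ?fK.
- by move=> k; rewrite mulrACA !sgz_sqr.
- move=> x; exists (x *m A^T *m invmx B^T); apply: key.
  by rewrite mulmxKV // unitmx_tr.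
move=> y; exists (y *m B^T *m invmx A^T); apply: key.
by rewrite mulmxKV // unitmx_tr.
Qed.

(** Permuting sign vectors and twisting them by the fixed signs [w] respects zeros, equality of
    entries and negation, hence the face relation. *)
Lemma cell_iso_model (s t : seq 'rV[R]_4) (V : seq (seq int)) :
  modelled s V -> modelled t V -> cell_iso s t.
Proof.
move=> hs ht; have [g [w [[g' gK g'K] ww h1 h2]]] := modelled_sign hs ht.
have w0 k : w k != 0 by apply: contra_eq_neq (ww k) => ->; rewrite mul0r eq_sym oner_eq0.
pose phi (sg : signv s) : signv t := [ffun k => w k * sg (g k)].
pose psi (tau : signv t) : signv s := [ffun i => w (g' i) * tau (g' i)].
have phiK tau : phi (psi tau) = tau.
  by apply/ffunP => k; rewrite !ffunE gK mulrA ww mul1r.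
have psiK sg : psi (phi sg) = sg.
  by apply/ffunP => k; rewrite !ffunE g'K mulrA ww mul1r.
have phi0 : phi [ffun=> 0] = [ffun=> 0] by apply/ffunP => k; rewrite !ffunE mulr0.
have phin sg : phi (negv sg) = negv (phi sg).
  by apply/ffunP => k; rewrite !ffunE mulrN.
have phif sg sg' : facele (phi sg) (phi sg') = facele sg sg'.
  apply/forallP/forallP => h k; last first.
    by rewrite !ffunE mulf_eq0 (negPf (w0 k)) /= (inj_eq (mulfI (w0 k))).
  by have := h (g' k); rewrite !ffunE mulf_eq0 (negPf (w0 _)) /= (inj_eq (mulfI (w0 _))) g'K.
exists phi; split.
- move=> sg [[x hx] sg0]; split; last first.
    by apply: contra_neq sg0 => h; rewrite -(psiK sg) h -phi0 psiK.
  by have [y hy] := h1 x; exists y => k; rewrite ffunE hx hy.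
- move=> tau [[y hy] tau0]; exists (psi tau); last by rewrite /pequiv phiK eqxx.
  split; last by apply: contra_neq tau0 => h; rewrite -(phiK tau) h phi0.
  have [x hx] := h2 y; exists x => i; rewrite ffunE hy hx g'K mulrA ww mul1r //.
by move=> sg sg' _ _; rewrite /pfacele -phin !phif.
Qed.

Definition imul (v : seq int) (M : seq (seq int)) : seq int :=
  [seq v`_0 * (nth [::] M 0)`_j + (v`_1 * (nth [::] M 1)`_j +
    (v`_2 * (nth [::] M 2)`_j + v`_3 * (nth [::] M 3)`_j)) | j <- iota 0 4].

Definition imx (M : seq (seq int)) : 'M[R]_4 := \matrix_i ivec R (nth [::] M i).

Lemma ivec_imul v M : ivec R v *m imx M = ivec R (imul v M).
Proof.
apply/rowP => j; rewrite [RHS]mxE ivec_nth4 mxE !big_ord_recl big_ord0 !mxE /=.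
by rewrite !rmorphD !rmorphM /= addr0.
Qed.

Lemma imx_unit M N (d : int) : d != 0 ->
  [seq imul (nth [::] M i) N | i <- iota 0 4] =
  [seq [seq (if j == i then d else 0) | j <- iota 0 4] | i <- iota 0 4] ->
  imx M \in unitmx.
Proof.
move=> d0 e; have dR : d%:~R != 0 :> R by rewrite intr_eq0.
have h : imx M *m imx N = d%:~R%:M.
  apply/row_matrixP => i; rewrite row_mul rowK ivec_imul.
  have hi : (i < 4)%N := ltn_ord i.
  have := congr1 (fun l => nth [::] l i) e.
  rewrite !(nth_map 0%N) ?size_iota // !nth_iota // add0n => ->.
  by apply/rowP => j; rewrite !mxE ivec_nth4 val_eqE eq_sym; case: eqP.
suff /mulmx1_unit [] : imx M *m (d%:~R^-1 *: imx N) = 1%:M by [].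
by rewrite -scalemxAr h scale_scalar_mx mulVf.
Qed.

Lemma modelled_map (V : seq (seq int)) (A : 'M[R]_4) : A \in unitmx ->
  modelled [seq ivec R v *m A | v <- V] V.
Proof.
move=> uA; have e : size [seq ivec R v *m A | v <- V] = size V by rewrite size_map.
exists A, (cast_ord e), (fun=> 1); split=> // [||i].
- by exists (cast_ord (esym e)) => k; apply: val_inj.
- by move=> i; rewrite oner_eq0.
by rewrite scale1r (nth_map [::]) //= -e.
Qed.

End CellIso.

(** * Root lists of A_4 and D_4 in simple-root coordinates, ordered as in [arrA4] and [arrD4] *)

Definition iA4 : seq (seq int) := [:: [:: 1; 0; 0; 0]; [:: 1; 1; 0; 0]; [:: 1; 1; 1; 0];
  [:: 1; 1; 1; 1]; [:: 0; 1; 0; 0]; [:: 0; 1; 1; 0]; [:: 0; 1; 1; 1]; [:: 0; 0; 1; 0];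
  [:: 0; 0; 1; 1]; [:: 0; 0; 0; 1]].

Definition iD4 : seq (seq int) := [:: [:: 1; 0; 0; 0]; [:: 1; 1; 0; 0]; [:: 1; 1; 1; 0];
  [:: 0; 1; 0; 0]; [:: 0; 1; 1; 0]; [:: 0; 0; 1; 0];
  [:: 1; 2; 1; 1]; [:: 1; 1; 1; 1]; [:: 1; 1; 0; 1];
  [:: 0; 1; 1; 1]; [:: 0; 1; 0; 1]; [:: 0; 0; 0; 1]].

(** The last row pulls back the difference of the last two coordinates of R^5, the fifth being minus
    the sum of the other four. *)
Definition simpleA4 : seq (seq int) :=
  [:: [:: 1; -1; 0; 0]; [:: 0; 1; -1; 0]; [:: 0; 0; 1; -1]; [:: 1; 1; 1; 2]].
Definition simpleD4 : seq (seq int) :=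
  [:: [:: 1; -1; 0; 0]; [:: 0; 1; -1; 0]; [:: 0; 0; 1; -1]; [:: 0; 0; 1; 1]].

(* [5] and [2] times the inverses of the two matrices above. *)
Definition inv5A4 : seq (seq int) :=
  [:: [:: 4; 3; 2; 1]; [:: -1; 3; 2; 1]; [:: -1; -2; 2; 1]; [:: -1; -2; -3; 1]].
Definition inv2D4 : seq (seq int) :=
  [:: [:: 2; 2; 1; 1]; [:: 0; 2; 1; 1]; [:: 0; 0; 1; 1]; [:: 0; 0; -1; 1]].

Section ReflectionArrangements.
Variable R : realType.

Lemma arrA4E : arrA4 R = [seq ivec R v *m imx R simpleA4 | v <- iA4].
Proof.
have -> : [seq ivec R v *m imx R simpleA4 | v <- iA4] =
   [seq ivec R u | u <- [seq imul v simpleA4 | v <- iA4]].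
  by rewrite -[RHS]map_comp; apply: eq_map => v; rewrite ivec_imul.
have enum5 : enum 'I_5 = [:: @Ordinal 5 0 isT; @Ordinal 5 1 isT; @Ordinal 5 2 isT;
    @Ordinal 5 3 isT; @Ordinal 5 4 isT].
  by apply: (inj_map val_inj); rewrite val_enum_ord.
have evE i : ev5 R i = delta_mx 0 i by apply/rowP => j; rewrite !mxE eqxx; case: eqP.
rewrite /arrA4 enum5 /=.
do 10 ?[congr cons]; rewrite !evE mulmxBl -!rowE; apply/rowP => j; rewrite !mxE;
  by case: j => [[|[|[|[|j]]]] hj] //=; lra.
Qed.

Lemma arrD4E : arrD4 R = [seq ivec R v *m imx R simpleD4 | v <- iD4].
Proof.
have -> : [seq ivec R v *m imx R simpleD4 | v <- iD4] =
   [seq ivec R u | u <- [seq imul v simpleD4 | v <- iD4]].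
  by rewrite -[RHS]map_comp; apply: eq_map => v; rewrite ivec_imul.
have enum4 : enum 'I_4 = [:: @Ordinal 4 0 isT; @Ordinal 4 1 isT; @Ordinal 4 2 isT;
    @Ordinal 4 3 isT].
  by apply: (inj_map val_inj); rewrite val_enum_ord.
rewrite /arrD4 enum4 /=.
do 12 ?[congr cons]; apply/rowP => j; rewrite !mxE;
  by case: j => [[|[|[|[|j]]]] hj] //=; lra.
Qed.

End ReflectionArrangements.

Definition flatsA4 : seq bitseq := Eval vm_compute in mflats iA4.
Definition flatsD4 : seq bitseq := Eval vm_compute in mflats iD4.

Lemma flatsA4_spec : mflats_spec iA4 flatsA4. Proof. by vm_compute. Qed.
Lemma flatsD4_spec : mflats_spec iD4 flatsD4. Proof. by vm_compute. Qed.

Definition lines_of_weight (V : seq (seq int)) (L : seq bitseq) (k : nat) : nat :=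
  count (fun K => (mrank V K == 2%N) && (count id K == k)) L.

Definition mcharpoly_coef (V : seq (seq int)) (L : seq bitseq) (i : nat) : int :=
  foldr +%R 0 [seq mmu V L 4 K | K <- L & mrank V K == i].

(** Tests all pairs of hyperplanes rather than pairs of walls of a chamber, so no chamber has to be
    enumerated. *)
Definition pairs_weight_le3 (V : seq (seq int)) : bool :=
  let n := size V in
  all (fun i => all (fun j => (i == j) ||
    (count id (mclosure V (set_nth false (set_nth false (nseq n false) j true) i true)) <= 3)%N)
    (iota 0 n)) (iota 0 n).

(** * Simple lacing, line counts and the characteristic polynomial from the model *)

Section Consequences.
Variables (R : realType) (s : seq 'rV[R]_4) (V : seq (seq int)) (L : seq bitseq).
Hypotheses (hs : modelled s V) (hL : mflats_spec V L).

Lemma model_simply_laced : pairs_weight_le3 V -> simply_laced s.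
Proof.
move=> hV; have [A [f [c [uA fb c0 es]]]] := hs; have fI := bij_inj fb.
move=> sg _ i j hij _ _.
have e0 : @flat R s set0 = mflat V A (nseq (size V) false).
  by apply: (flat_mflat uA fb c0 es) => m; rewrite inE nth_nseq if_same.
have e1 := mflat_setbit uA c0 es j e0; have := mflat_setbit uA c0 es i e1.
rewrite setU0 => e2; have [K KL e3] := flat_in_model uA fb c0 es hL [set i; j].
have eK := mclosure_eq uA (etrans (esym e3) e2).
rewrite e3 (weight_mflat uA fb c0 es hL KL).
have -> : K = mclosure V K by case/and4P: hL => _ _ /allP /(_ _ KL) /andP [_ /eqP].
rewrite eK.
have fin (m : 'I_(size s)) : val (f m) \in iota 0 (size V) by rewrite mem_iota /=.
have /allP /(_ _ (fin j)) := allP hV _ (fin i).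
by rewrite val_eqE (inj_eq fI) (negPf hij).
Qed.

Lemma model_grunbaum_shephard :
  (sumn [seq lines_of_weight V L k | k <- iota 3 (size V - 2)] < lines_of_weight V L 2)%N ->
  grunbaum_shephard s.
Proof.
have [A [f [c [uA fb c0 es]]]] := hs => h; rewrite /grunbaum_shephard.
rewrite (hnum_model uA fb c0 es hL); apply: leq_ltn_trans h.
rewrite sumnE big_map /index_iota (size_model fb) subSS.
by apply: eq_leq; apply: eq_bigr => k _; rewrite (hnum_model uA fb c0 es hL).
Qed.

Lemma sum_by_degree (m : bitseq -> int) (r : bitseq -> nat) :
  all (fun K => r K < 5)%N L ->
  \sum_(K <- L) (m K)%:~R *: 'X^(r K) =
  \sum_(i < 5) (foldr +%R 0 [seq m K | K <- L & r K == i])%:~R *: 'X^i :> {poly R}.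
Proof.
move=> /allP hr.
have e i : (foldr +%R 0 [seq m K | K <- L & r K == i])%:~R = \sum_(K <- L | r K == i) (m K)%:~R :> R.
  by rewrite -rmorph_sum /= -big_filter unlock /reducebig foldr_map.
under [RHS]eq_bigr => i _ do rewrite e scaler_suml.
rewrite (exchange_big_dep xpredT) //=; apply: eq_big_seq => K KL.
by rewrite (big_pred1 (Ordinal (hr K KL))) // => i; rewrite /= -val_eqE eq_sym.
Qed.

Lemma model_charpoly : all (fun K => mrank V K < 5)%N L ->
  charpoly s = \sum_(i < 5) (mcharpoly_coef V L i)%:~R *: 'X^i.
Proof.
move=> hr; have [A [f [c [uA fb c0 es]]]] := hs.
by rewrite (charpoly_model uA fb c0 es hL) sum_by_degree.
Qed.

End Consequences.

Lemma splits_prod (R : realType) (rs : seq R) (p : {poly R}) :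
  p = \prod_(r <- rs) ('X - r%:P) -> splits_over_R p.
Proof.
move=> e; exists rs.
by rewrite {2}e (monicP (monic_prod_XsubC rs xpredT id)) scale1r.
Qed.

Section Exponents.
Variable R : realType.

Lemma charpolyA4 (s : seq 'rV[R]_4) : modelled s iA4 -> splits_over_R (charpoly s).
Proof.
(* The roots are the exponents of the Coxeter group A_4. *)
move=> hs; apply: (@splits_prod R [:: 1; 2; 3; 4]).
have hr : all (fun K => mrank iA4 K < 5)%N flatsA4 by vm_compute.
rewrite (model_charpoly hs flatsA4_spec hr).
have : [seq mcharpoly_coef iA4 flatsA4 i | i <- iota 0 5] = [:: 24; -50; 35; -10; 1].
  by vm_compute.
move: (mcharpoly_coef iA4 flatsA4) => co [e0 e1 e2 e3 e4].
rewrite !big_ord_recl big_ord0 /bump /= e0 e1 e2 e3 e4 !big_cons big_nil.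
rewrite -!mul_polyC !rmorph_int !rmorph_nat rmorph1.
ring.
Qed.

Lemma charpolyD4 (s : seq 'rV[R]_4) : modelled s iD4 -> splits_over_R (charpoly s).
Proof.
(* The exponents of D_4. *)
move=> hs; apply: (@splits_prod R [:: 1; 3; 3; 5]).
have hr : all (fun K => mrank iD4 K < 5)%N flatsD4 by vm_compute.
rewrite (model_charpoly hs flatsD4_spec hr).
have : [seq mcharpoly_coef iD4 flatsD4 i | i <- iota 0 5] = [:: 45; -84; 50; -12; 1].
  by vm_compute.
move: (mcharpoly_coef iD4 flatsD4) => co [e0 e1 e2 e3 e4].
rewrite !big_ord_recl big_ord0 /bump /= e0 e1 e2 e3 e4 !big_cons big_nil.
rewrite -!mul_polyC !rmorph_int !rmorph_nat rmorph1.
ring.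
Qed.

End Exponents.

Theorem theorem3 (R : realType) (s : seq 'rV[R]_4) :
  is_arrangement s -> irreducible s -> simplicial s -> mA s = 6%N ->
  (cell_iso s (arrA4 R) \/ cell_iso s (arrD4 R)) /\
  [/\ simply_laced s, grunbaum_shephard s & splits_over_R (charpoly s)].
Proof.
move=> arr irr spl m6; have [x hx] := generic_point arr.
have [A bA [hA | hA]] := standard_form arr spl m6 irr hx.
  have hs : modelled s iA4.
    by apply: (model_of_base arr spl m6 irr _ _ _ bA hA); vm_compute.
  have ht : modelled (arrA4 R) iA4.
    by rewrite arrA4E; apply: modelled_map; apply: (@imx_unit R simpleA4 inv5A4 5).
  split; first by left; apply: cell_iso_model hs ht.
  split; [apply: (model_simply_laced hs flatsA4_spec); by vm_compute | | exact: charpolyA4].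
  by apply: (model_grunbaum_shephard hs flatsA4_spec); vm_compute.
have hs : modelled s iD4.
  by apply: (model_of_base arr spl m6 irr _ _ _ bA hA); vm_compute.
have ht : modelled (arrD4 R) iD4.
  by rewrite arrD4E; apply: modelled_map; apply: (@imx_unit R simpleD4 inv2D4 2).
split; first by right; apply: cell_iso_model hs ht.
split; [apply: (model_simply_laced hs flatsD4_spec); by vm_compute | | exact: charpolyD4].
by apply: (model_grunbaum_shephard hs flatsD4_spec); vm_compute.
Qed.
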